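(* Let $0<\eta<T$, $0<\alpha<\frac{2T}{\eta^2}$ and $0\le\beta<\frac{2T-\alpha\eta^2}{\alpha\eta^2-2\eta+2T}$ be real constants. Let $f\in C([0,\infty),[0,\infty))$, and let $a\in C([0,T],[0,\infty))$ be such that there exists $t_0\in[\eta,T]$ with $a(t_0)>0$. Let $\gamma$, $\Lambda_1$ and $\Lambda_2$ be the constants defined in the context. Assume that (i) the limit $\lim_{u\to0^+}\frac{f(u)}{u}=\alpha_1$ exists with $\alpha_1\in[0,\theta_1\Lambda_1)$, where $\theta_1\in(0,1]$; (ii) the limit $\lim_{u\to\infty}\frac{f(u)}{u}=\beta_1$ exists with $\beta_1\in\left(\frac{\theta_2}{\gamma}\Lambda_2,\infty\right)$, where $\theta_2\ge1$. Then the boundary value problem $$u''(t)+a(t)f(u(t))=0,\quad 0<t<T,\qquad u(0)=\beta u(\eta),\quad u(T)=\alpha\int_0^\eta u(s)\,ds,$$ has at least one positive solution.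
   Context: A positive solution of the boundary value problem is a function $u\in C([0,T])$, twice continuously differentiable on $(0,T)$, satisfying the differential equation on $(0,T)$ and both boundary conditions, with $u(t)\ge0$ on $[0,T]$ and $u(t)>0$ for $t\in(0,T)$. Define $$\gamma=\min\left\{\frac{\eta}{T},\ \frac{\alpha(\beta+1)\eta^2}{2T},\ \frac{\alpha(\beta+1)\eta(T-\eta)}{2T-\alpha(\beta+1)\eta^2}\right\}\in(0,1),$$ $$\Lambda_1=\frac{(2T-\alpha\eta^2)-\beta(\alpha\eta^2-2\eta+2T)}{\left[2(\beta+1)+T^{-1}\beta\eta(\alpha\eta+2)+\alpha\beta T\right]\int_0^T T(T-s)a(s)\,ds},$$ $$\Lambda_2=\frac{(2T-\alpha\eta^2)-\beta(\alpha\eta^2-2\eta+2T)}{2\gamma\eta\int_\eta^T(T-s)a(s)\,ds}.$$ *)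

(* Defs.v *)
From Stdlib Require Import Reals.
From Coquelicot Require Import Coquelicot.
Open Scope R_scope.

Definition gamma (T eta alpha beta : R) : R :=
  Rmin (eta / T)
    (Rmin (alpha * (beta + 1) * eta ^ 2 / (2 * T))
          (alpha * (beta + 1) * eta * (T - eta)
             / (2 * T - alpha * (beta + 1) * eta ^ 2))).

Definition Lambda1 (T eta alpha beta : R) (a : R -> R) : R :=
  ((2 * T - alpha * eta ^ 2) - beta * (alpha * eta ^ 2 - 2 * eta + 2 * T))
  / ((2 * (beta + 1) + / T * beta * eta * (alpha * eta + 2) + alpha * beta * T)
     * RInt (fun s => T * (T - s) * a s) 0 T).

Definition Lambda2 (T eta alpha beta : R) (a : R -> R) : R :=
  ((2 * T - alpha * eta ^ 2) - beta * (alpha * eta ^ 2 - 2 * eta + 2 * T))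
  / (2 * gamma T eta alpha beta * eta
     * RInt (fun s => (T - s) * a s) eta T).

(* Functions on an interval are represented by total functions R -> R whose
   values off the interval play no role: [continuous_on] is continuity relative
   to the set, so it is one-sided at the endpoints. *)

Definition C2_on_open (l r : R) (u : R -> R) : Prop :=
  forall t, l < t < r ->
    ex_derive u t /\ ex_derive (Derive u) t /\ continuous (Derive_n u 2) t.

Definition solves_bvp (T eta alpha beta : R) (f a u : R -> R) : Prop :=
  (forall t, 0 < t < T -> Derive_n u 2 t + a t * f (u t) = 0) /\
  u 0 = beta * u eta /\
  u T = alpha * RInt u 0 eta.

Definition positive_solution (T eta alpha beta : R) (f a u : R -> R) : Prop :=
  continuous_on (fun t => 0 <= t <= T) u /\
  C2_on_open 0 T u /\
  solves_bvp T eta alpha beta f a u /\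
  (forall t, 0 <= t <= T -> 0 <= u t) /\
  (forall t, 0 < t < T -> 0 < u t).

(* Main.v *)
Require Import Defs.
From Stdlib Require Import Reals Lra Lia Psatz Bool Classical IndefiniteDescription.
From Coquelicot Require Import Coquelicot.
From mathcomp Require filter.
Open Scope R_scope.

(** The solution is found by two-parameter shooting. Let [u'' = - a F(u)] with [F]
    a bounded truncation of [f] vanishing on negative arguments, and parametrize the
    initial data by [r = u 0 + u' 0 * eta] and [s] in [0, 1] through [u 0 = beta s r].
    The boundary conditions become [G1 = s r - (u eta)^+ = 0] and
    [G2 = u T - alpha * int_0^eta u^+ = 0]. Concavity gives the signs of [G1] at
    [s = 0] and [s = 1]. On the set [G1 = 0], the slope of [f] at 0 (less than
    [Lambda1]) forces [G2 > 0] for small [r], and its slope at infinity (more than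
    [Lambda2]) forces [G2 < 0] for large [r], so a Poincare-Miranda argument yields
    a common zero.

    As [f] is only continuous, the flow need not be single-valued. The planar
    argument is therefore run, up to an error [1 / (n + 1)], on the explicit Euler
    scheme of step [eta / (n + 1)], and the resulting approximate solutions converge
    along an ultrafilter on [nat] to an exact one. *)

(** * Limits along an ultrafilter *)

(** The parameter [r] is the value at [eta] of the tangent at 0. Concavity keeps [u eta] below it,
    which is the sign of [G1] at [s = 1], and both [u 0] and the tangent at [T] are then bounded by
    a multiple of [r]. Positive parts enter because trial solutions may change sign; positivity is
    recovered once the boundary conditions hold.

    The signs of [G2] at the two ends are available only on the set [G1 = 0] and only for exact
    solutions, so a planar theorem with prescribed signs on all four sides does not apply to the
    Euler maps. The sides [r = r0] and [r = r1] are therefore carried through the limit as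
    alternatives and excluded afterwards.

    The constants come from linear algebra: the common numerator of [Lambda1] and [Lambda2] is twice
    the determinant of the boundary conditions on affine functions, and both estimates are Cramer's
    rule for the tangent at 0, with the gaps between [u] and this tangent as data.

    A single ultrafilter gives the limits of the parameters and of all grid values at once, with no
    successive extraction of subsequences. *)

Lemma nat_ultrafilter :
  exists U : (nat -> Prop) -> Prop,
    ProperFilter U /\
    (forall P, U P \/ U (fun n => ~ P n)) /\
    (forall N, U (fun n => (N <= n)%nat)).
Proof.
  assert (HF : @filter.ProperFilter nat eventually).
  { constructor.
    - intros [N HN]. exact (HN N (le_n N)).
    - constructor.
      + now exists 0%nat.
      + intros P Q [N HN] [M HM]. exists (max N M). intros n Hn.
        split; [apply HN | apply HM]; lia.
      + intros P Q HPQ [N HN]. exists N. intros n Hn. apply HPQ, HN, Hn. }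
  (* The ultrafilter extends [eventually], hence is free: whatever tends to 0 with [n] tends to 0
     along it. *)
  destruct (filter.ultraFilterLemma HF) as [U [HU HsubU]].
  destruct (filter.ultra_proper (UltraFilter := HU)) as [Hne [HT HI HS]].
  exists U. split; [split | split].
  - intros P HP. apply NNPP. intros Hno. apply Hne.
    apply (HS P); [|exact HP]. intros n Hn. exfalso. apply Hno. now exists n.
  - split.
    + exact HT.
    + intros P Q HP HQ. exact (HI P Q HP HQ).
    + intros P Q HPQ HP. exact (HS P Q HPQ HP).
  - intros P. exact (filter.in_ultra_setVsetC P HU).
  - intros N. apply HsubU. exists N. auto.
Qed.

Lemma filterlim_R_eps (U : (nat -> Prop) -> Prop) (x : nat -> R) (l : R) :
  Filter U ->
  filterlim x U (locally l)
  <-> (forall eps, 0 < eps -> U (fun n => Rabs (x n - l) < eps)).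
Proof.
  intros HU. split.
  - intros H eps He.
    exact (proj1 (filterlim_locally (F := U) x l) H (mkposreal eps He)).
  - intros H. apply (filterlim_locally (F := U)). intros [eps He]. exact (H eps He).
Qed.

(** The limit is the supremum of the levels that [x] reaches on a set of [U]: maximality of [U]
    decides, for each level, on which side of it [x] lies. *)
Lemma bounded_ultralimit (U : (nat -> Prop) -> Prop) (x : nat -> R) (C : R) :
  ProperFilter U -> (forall P, U P \/ U (fun n => ~ P n)) ->
  U (fun n => Rabs (x n) <= C) ->
  exists l, filterlim x U (locally l).
Proof.
  intros HU Hult Hb.
  destruct (completeness (fun r => U (fun n => r <= x n))) as [l [Hub Hlub]].
  - exists C. intros r Hr.
    destruct (filter_ex _ (filter_and _ _ Hr Hb)) as [n [H1 H2]].
    apply Rabs_le_between in H2. lra.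
  - exists (- C). apply (filter_imp _ _ (fun n H => proj1 (proj1 (Rabs_le_between _ _) H)) Hb).
  - exists l. apply filterlim_R_eps; [apply HU|]. intros eps He.
    assert (Hhi : U (fun n => x n < l + eps)).
    { destruct (Hult (fun n => l + eps / 2 <= x n)) as [H | H].
      - specialize (Hub _ H). lra.
      - revert H. apply filter_imp. intros n Hn. lra. }
    assert (Hlo : U (fun n => l - eps < x n)).
    { destruct (Hult (fun n => l - eps < x n)) as [H | H]; [exact H|].
      exfalso. assert (Hl : l <= l - eps); [|lra].
      apply Hlub. intros r Hr.
      destruct (filter_ex _ (filter_and _ _ Hr H)) as [n [H1 H2]]. lra. }
    generalize (filter_and _ _ Hhi Hlo). apply filter_imp.
    intros n [H1 H2]. apply Rabs_lt_between. lra.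
Qed.

Lemma filterlim_R_plus (U : (nat -> Prop) -> Prop) (x y : nat -> R) (l m : R) :
  Filter U -> filterlim x U (locally l) -> filterlim y U (locally m) ->
  filterlim (fun n => x n + y n) U (locally (l + m)).
Proof.
  intros HU Hx Hy.
  exact (filterlim_comp_2 x y Rplus Hx Hy (filterlim_plus l m)).
Qed.

Lemma filterlim_R_scal (U : (nat -> Prop) -> Prop) (c : R) (x : nat -> R) (l : R) :
  Filter U -> filterlim x U (locally l) ->
  filterlim (fun n => c * x n) U (locally (c * l)).
Proof.
  intros HU Hx. exact (filterlim_comp _ _ _ x (Rmult c) U _ _ Hx (filterlim_scal_r c l)).
Qed.

Lemma filterlim_R_minus (U : (nat -> Prop) -> Prop) (x y : nat -> R) (l m : R) :
  Filter U -> filterlim x U (locally l) -> filterlim y U (locally m) ->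
  filterlim (fun n => x n - y n) U (locally (l - m)).
Proof.
  intros HU Hx Hy.
  replace (l - m) with (l + (-1) * m) by ring.
  apply (filterlim_ext (fun n => x n + (-1) * y n)); [intros; ring|].
  apply filterlim_R_plus; auto. now apply filterlim_R_scal.
Qed.

Lemma filterlim_R_mult (U : (nat -> Prop) -> Prop) (x y : nat -> R) (l m : R) :
  Filter U -> filterlim x U (locally l) -> filterlim y U (locally m) ->
  filterlim (fun n => x n * y n) U (locally (l * m)).
Proof.
  intros HU Hx Hy.
  exact (filterlim_comp_2 x y Rmult Hx Hy (filterlim_mult l m)).
Qed.

Lemma filterlim_R_le (U : (nat -> Prop) -> Prop) (x y : nat -> R) (l m : R) :
  ProperFilter U -> filterlim x U (locally l) -> filterlim y U (locally m) ->
  U (fun n => x n <= y n) -> l <= m.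
Proof.
  intros HU Hx Hy Hle.
  exact (filterlim_le (F := U) x y (Finite l) (Finite m) Hle Hx Hy).
Qed.

Lemma continuous_Rmax0 (x : R) : continuous (fun z => Rmax z 0) x.
Proof.
  apply (continuous_ext (fun z => (z + Rabs z) / 2)).
  - intros z. unfold Rmax. destruct (Rle_dec z 0).
    + rewrite Rabs_left1 by lra. lra.
    + rewrite Rabs_pos_eq by lra. lra.
  - apply (continuous_mult (fun z : R => z + Rabs z) (fun _ => / 2));
      [|apply continuous_const].
    apply (continuous_plus (fun z : R => z) (fun z : R => Rabs z)).
    + apply continuous_id.
    + apply (continuous_Rabs x).
Qed.

Lemma Rmax0_lipschitz (x y : R) : Rabs (Rmax x 0 - Rmax y 0) <= Rabs (x - y).
Proof.
  unfold Rmax. destruct (Rle_dec x 0), (Rle_dec y 0); unfold Rabs;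
    repeat destruct Rcase_abs; lra.
Qed.

Lemma filterlim_R_pos_part (U : (nat -> Prop) -> Prop) (x : nat -> R) (l : R) :
  Filter U -> filterlim x U (locally l) ->
  filterlim (fun n => Rmax (x n) 0) U (locally (Rmax l 0)).
Proof.
  intros HU Hx.
  exact (filterlim_comp _ _ _ x (fun z => Rmax z 0) U _ _ Hx (continuous_Rmax0 l)).
Qed.

(** * A planar zero theorem from Sperner's parity argument *)

(* A vertex has label 1 if [p] holds, otherwise label 2 or 3 according to [q]. *)
Definition edge12 (p q p' q' : bool) : bool :=
  (p && negb p' && q') || (p' && negb p && q).

Fixpoint parity12 (p q : nat -> bool) (n : nat) : bool :=
  match n with
  | O => false
  | S n => xorb (parity12 p q n) (edge12 (p n) (q n) (p (S n)) (q (S n)))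
  end.

(** Sup-distance at most 1, which holds for any two vertices of a triangle obtained by cutting a
    grid square along a diagonal. *)
Definition unit_cell (x y : nat * nat) : Prop :=
  (fst x <= S (fst y) /\ fst y <= S (fst x) /\
   snd x <= S (snd y) /\ snd y <= S (snd x))%nat.

(** An odd number of 1-2 edges forces the labels 1, 2, 3. The conclusion locates label 1 and leaves
    open which of the other two vertices carries 2. *)
Lemma edge12_triangle (p1 q1 p2 q2 p3 q3 : bool) :
  xorb (edge12 p1 q1 p2 q2) (xorb (edge12 p2 q2 p3 q3) (edge12 p1 q1 p3 q3)) = true ->
  (p1 = true /\ (p2 = false /\ p3 = false /\ q2 = negb q3)) \/
  (p2 = true /\ (p1 = false /\ p3 = false /\ q1 = negb q3)) \/
  (p3 = true /\ (p1 = false /\ p2 = false /\ q1 = negb q2)).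
Proof.
  destruct p1, q1, p2, q2, p3, q3; cbn; intros; try discriminate; auto 10.
Qed.

(** If every neighbour of a 1 that is not a 1 carries 2, the 1-2 edges are exactly the changes of
    [p], and their parity depends on the endpoints only. *)
Lemma parity12_transitions (p q : nat -> bool) (n : nat) :
  (forall i, (i < n)%nat -> p i = true -> p (S i) = false -> q (S i) = true) ->
  (forall i, (i < n)%nat -> p i = false -> p (S i) = true -> q i = true) ->
  parity12 p q n = xorb (p 0%nat) (p n).
Proof.
  intros H1 H2. induction n as [|n IH]; cbn.
  - now rewrite xorb_nilpotent.
  - rewrite IH by (intros i Hi; first [apply H1 | apply H2]; lia).
    specialize (H1 n (le_n _)). specialize (H2 n (le_n _)). unfold edge12.
    destruct (p 0%nat), (p n), (p (S n)), (q n), (q (S n)); cbn in *; auto;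
      try (discriminate H1; reflexivity); try (discriminate H2; reflexivity).
Qed.

Lemma parity12_none (p q : nat -> bool) (n : nat) :
  (forall i, (i < n)%nat -> p i = true -> p (S i) = false -> q (S i) = false) ->
  (forall i, (i < n)%nat -> p i = false -> p (S i) = true -> q i = false) ->
  parity12 p q n = false.
Proof.
  intros H1 H2. induction n as [|n IH]; cbn; [reflexivity|].
  rewrite IH by (intros i Hi; first [apply H1 | apply H2]; lia).
  specialize (H1 n (le_n _)). specialize (H2 n (le_n _)). unfold edge12.
  destruct (p n), (p (S n)), (q n), (q (S n)); cbn in *; auto;
    try (discriminate H1; reflexivity); try (discriminate H2; reflexivity).
Qed.

(* The number of 1-2 edges of a row has the same parity in every row as long as
   no triangle of the strips in between carries all three labels. *)
Lemma sperner_rectangle (p q : nat -> nat -> bool) (N M : nat) :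
  (forall j, (j <= M)%nat -> p 0%nat j = true) ->
  (forall j, (j <= M)%nat -> p N j = false) ->
  exists x y z : nat * nat,
    (fst x <= N /\ snd x <= M /\ fst y <= N /\ snd y <= M /\
     fst z <= N /\ snd z <= M)%nat /\
    unit_cell x y /\ unit_cell x z /\
    p (fst x) (snd x) = true /\
    p (fst y) (snd y) = false /\ p (fst z) (snd z) = false /\
    (q (fst y) (snd y) = true \/ snd y = 0%nat) /\
    (q (fst z) (snd z) = false \/ snd z = M).
Proof.
  intros Hl Hr. apply NNPP. intros Hno.
  (* In a triangle with all three labels, the vertex labelled 2 would serve as [y] and the one
     labelled 3 as [z]. *)
  assert (Htri : forall x y z,
    (fst x <= N /\ snd x <= M /\ fst y <= N /\ snd y <= M /\
     fst z <= N /\ snd z <= M)%nat ->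
    unit_cell x y -> unit_cell x z -> unit_cell y z ->
    xorb (edge12 (p (fst x) (snd x)) (q (fst x) (snd x))
                 (p (fst y) (snd y)) (q (fst y) (snd y)))
      (xorb (edge12 (p (fst y) (snd y)) (q (fst y) (snd y))
                    (p (fst z) (snd z)) (q (fst z) (snd z)))
            (edge12 (p (fst x) (snd x)) (q (fst x) (snd x))
                    (p (fst z) (snd z)) (q (fst z) (snd z)))) = false).
  { intros x y z Hb Hxy Hxz Hyz. apply not_true_is_false. intros E.
    assert (Hs : forall a b, unit_cell a b -> unit_cell b a)
      by (unfold unit_cell; intros; lia).
    apply edge12_triangle in E.
    destruct E as [(H1 & H2 & H3 & H4) | [(H1 & H2 & H3 & H4) | (H1 & H2 & H3 & H4)]];
      apply Hno.
    - destruct (q (fst z) (snd z)) eqn:E.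
      + exists x, z, y. intuition.
      + exists x, y, z. intuition.
    - destruct (q (fst z) (snd z)) eqn:E.
      + exists y, z, x. intuition.
      + exists y, x, z. intuition.
    - destruct (q (fst y) (snd y)) eqn:E.
      + exists z, y, x. intuition.
      + exists z, x, y. intuition. }
  (* Sum over the triangles of the strip between rows [j] and [S j], each square being cut from
     [(i, j)] to [(S i, S j)]. Inner edges cancel; the vertical edge in column 0 joins two labels 1
     and counts for nothing, so only the one in column [i] remains. *)
  assert (Hstep : forall j, (j < M)%nat -> forall i, (i <= N)%nat ->
    xorb (parity12 (fun i => p i j) (fun i => q i j) i)
         (parity12 (fun i => p i (S j)) (fun i => q i (S j)) i)
    = edge12 (p i j) (q i j) (p i (S j)) (q i (S j))).
  { intros j Hj i. induction i as [|i IH]; intros Hi.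
    - cbn. unfold edge12. rewrite !Hl by lia. reflexivity.
    - specialize (IH ltac:(lia)). cbn.
      assert (T1 := Htri (i, j) (S i, j) (S i, S j)
        ltac:(cbn; lia) ltac:(unfold unit_cell; cbn; lia)
        ltac:(unfold unit_cell; cbn; lia) ltac:(unfold unit_cell; cbn; lia)).
      assert (T2 := Htri (i, j) (i, S j) (S i, S j)
        ltac:(cbn; lia) ltac:(unfold unit_cell; cbn; lia)
        ltac:(unfold unit_cell; cbn; lia) ltac:(unfold unit_cell; cbn; lia)).
      cbn in T1, T2. revert IH T1 T2.
      generalize (parity12 (fun i => p i j) (fun i => q i j) i)
        (parity12 (fun i => p i (S j)) (fun i => q i (S j)) i)
        (edge12 (p i j) (q i j) (p i (S j)) (q i (S j)))
        (edge12 (p i j) (q i j) (p (S i) j) (q (S i) j))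
        (edge12 (p (S i) j) (q (S i) j) (p (S i) (S j)) (q (S i) (S j)))
        (edge12 (p i j) (q i j) (p (S i) (S j)) (q (S i) (S j)))
        (edge12 (p i (S j)) (q i (S j)) (p (S i) (S j)) (q (S i) (S j))).
      intros b1 b2 b3 b4 b5 b6 b7. destruct b1, b2, b3, b4, b5, b6, b7; cbn; auto. }
  assert (Hrows : forall j, (j <= M)%nat ->
    parity12 (fun i => p i j) (fun i => q i j) N
    = parity12 (fun i => p i 0%nat) (fun i => q i 0%nat) N).
  { intros j. induction j as [|j IH]; intros Hj; [reflexivity|].
    rewrite <- IH by lia. specialize (Hstep j ltac:(lia) N (le_n _)).
    unfold edge12 in Hstep. rewrite !Hr in Hstep by lia. cbn in Hstep.
    symmetry. now apply xorb_eq. }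
  (* A degenerate triple with [y = z] is also excluded by [Hno]. On the bottom row this makes every
     such neighbour of a 1 a 2, so the row has odd parity; on the top row it makes them all 3, so
     the parity there is even. *)
  assert (Hbot : forall i i', (i <= N)%nat -> (i' <= N)%nat ->
    (i <= S i' /\ i' <= S i)%nat -> p i 0%nat = true -> p i' 0%nat = false ->
    q i' 0%nat = true).
  { intros i i' Hi Hi' Hc H1 H2. apply not_false_is_true. intros H3. apply Hno.
    exists (i, 0%nat), (i', 0%nat), (i', 0%nat). unfold unit_cell. cbn.
    repeat split; try lia; auto. }
  assert (Htop : forall i i', (i <= N)%nat -> (i' <= N)%nat ->
    (i <= S i' /\ i' <= S i)%nat -> p i M = true -> p i' M = false ->
    q i' M = false).
  { intros i i' Hi Hi' Hc H1 H2. apply not_true_is_false. intros H3. apply Hno.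
    exists (i, M), (i', M), (i', M). unfold unit_cell. cbn.
    repeat split; try lia; auto. }
  specialize (Hrows M (le_n _)).
  rewrite parity12_none, parity12_transitions in Hrows.
  - rewrite Hl, Hr in Hrows by lia. discriminate.
  - intros i Hi H1 H2. apply (Hbot i (S i)); auto; lia.
  - intros i Hi H1 H2. apply (Hbot (S i) i); auto; lia.
  - intros i Hi H1 H2. apply (Htop i (S i)); auto; lia.
  - intros i Hi H1 H2. apply (Htop (S i) i); auto; lia.
Qed.

(* Approximate Poincare-Miranda: no sign of [G2] is required on the sides
   [r = r0] and [r = r1]; instead these sides appear as alternatives. *)
Lemma approximate_planar_zero (G1 G2 : R -> R -> R) (r0 r1 : R) :
  r0 < r1 ->
  (forall e, 0 < e -> exists d, 0 < d /\ forall s s' r r',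
     0 <= s <= 1 -> 0 <= s' <= 1 -> r0 <= r <= r1 -> r0 <= r' <= r1 ->
     Rabs (s - s') < d -> Rabs (r - r') < d ->
     Rabs (G1 s r - G1 s' r') < e /\ Rabs (G2 s r - G2 s' r') < e) ->
  (forall r, r0 <= r <= r1 -> G1 0 r <= 0) ->
  (forall r, r0 <= r <= r1 -> 0 <= G1 1 r) ->
  forall e, 0 < e ->
  exists s r, 0 <= s <= 1 /\ r0 <= r <= r1 /\ Rabs (G1 s r) <= e /\
    (- e <= G2 s r \/ r <= r0 + e) /\ (G2 s r <= e \/ r1 - e <= r).
Proof.
  intros Hr Huc Hleft Hright e He.
  destruct (Huc e He) as [d [Hd HG]].
  (* The mesh of the grid, in both parameters, is to be smaller than the modulus [d] and the
     tolerance [e]. *)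
  destruct (archimed_cor1 (Rmin (Rmin d e) 1 / (1 + (r1 - r0)))) as [N [HN HN0]].
  { apply Rdiv_lt_0_compat; [|lra].
    repeat apply Rmin_glb_lt; lra. }
  assert (HNR : 0 < INR N) by (apply lt_0_INR; lia).
  assert (HNm : (1 + (r1 - r0)) * / INR N < Rmin d e).
  { apply Rlt_le_trans with (Rmin (Rmin d e) 1); [|apply Rmin_l].
    apply (Rmult_lt_compat_l (1 + (r1 - r0))) in HN; [|lra].
    replace ((1 + (r1 - r0)) * (Rmin (Rmin d e) 1 / (1 + (r1 - r0))))
      with (Rmin (Rmin d e) 1) in HN by (field; lra). exact HN. }
  assert (HNd := Rlt_le_trans _ _ _ HNm (Rmin_l d e)).
  assert (HNe := Rlt_le_trans _ _ _ HNm (Rmin_r d e)). clear HN HNm.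
  assert (HiN : 0 < / INR N) by now apply Rinv_0_lt_compat.
  set (sg := fun i : nat => INR i / INR N).
  set (rg := fun j : nat => r0 + (r1 - r0) * (INR j / INR N)).
  assert (Hsg : forall i, (i <= N)%nat -> 0 <= sg i <= 1).
  { intros i Hi. unfold sg. apply le_INR in Hi. assert (Hp := pos_INR i). split.
    - apply Rdiv_le_0_compat; lra.
    - apply Rle_div_l; lra. }
  assert (Hrg : forall j, (j <= N)%nat -> r0 <= rg j <= r1).
  { intros j Hj. specialize (Hsg j Hj). fold (sg j) in *. unfold rg. fold (sg j).
    split; nra. }
  assert (Hcl : forall i i', (i <= S i')%nat -> (i' <= S i)%nat ->
    Rabs (sg i - sg i') <= / INR N).
  { intros i i' H1 H2. apply le_INR in H1, H2. rewrite S_INR in H1, H2.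
    unfold sg. replace (INR i / INR N - INR i' / INR N) with ((INR i - INR i') * / INR N)
      by (unfold Rdiv; ring).
    rewrite Rabs_mult, (Rabs_pos_eq (/ INR N)) by lra.
    assert (Rabs (INR i - INR i') <= 1) by (apply Rabs_le_between; lra). nra. }
  (* Label 1 means [G1 < 0], except that the labels of the sides [s = 0] and [s = 1] are forced,
     only weak inequalities being known there. [Hp1] and [Hp2] show that every label still agrees
     with a weak sign of [G1]. *)
  set (p := fun i j : nat => if Nat.eqb i 0 then true else if Nat.eqb i N then false
     else if Rlt_dec (G1 (sg i) (rg j)) 0 then true else false).
  set (q := fun i j : nat => if Rle_dec 0 (G2 (sg i) (rg j)) then true else false).
  assert (Hp1 : forall i j, (i <= N)%nat -> (j <= N)%nat -> p i j = true ->
     G1 (sg i) (rg j) <= 0).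
  { intros i j Hi Hj. unfold p. destruct (Nat.eqb_spec i 0) as [->|].
    - intros _. replace (sg 0%nat) with 0 by (unfold sg; cbn; field; lra).
      apply Hleft. now apply Hrg.
    - destruct (Nat.eqb i N); [discriminate|]. destruct Rlt_dec; [lra|discriminate]. }
  assert (Hp2 : forall i j, (i <= N)%nat -> (j <= N)%nat -> p i j = false ->
     0 <= G1 (sg i) (rg j)).
  { intros i j Hi Hj. unfold p. destruct (Nat.eqb_spec i 0); [discriminate|].
    destruct (Nat.eqb_spec i N) as [->|].
    - intros _. replace (sg N) with 1 by (unfold sg; field; lra).
      apply Hright. now apply Hrg.
    - destruct Rlt_dec; [discriminate|lra]. }
  destruct (sperner_rectangle p q N N) as (x & y & z & Hb & Hxy & Hxz & Hx & Hy & Hz & Hy2 & Hz2).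
  { intros j _. reflexivity. }
  { intros j _. unfold p. destruct (Nat.eqb_spec N 0); [lia|].
    now rewrite Nat.eqb_refl. }
  destruct Hb as (B1 & B2 & B3 & B4 & B5 & B6).
  assert (Hclose : forall w, (fst w <= N)%nat -> (snd w <= N)%nat -> unit_cell x w ->
    Rabs (G1 (sg (fst x)) (rg (snd x)) - G1 (sg (fst w)) (rg (snd w))) < e /\
    Rabs (G2 (sg (fst x)) (rg (snd x)) - G2 (sg (fst w)) (rg (snd w))) < e /\
    Rabs (rg (snd x) - rg (snd w)) < e).
  { intros w W1 W2 (C1 & C2 & C3 & C4).
    assert (D1 := Hcl _ _ C1 C2). assert (D2 := Hcl _ _ C3 C4).
    assert (D3 : Rabs (rg (snd x) - rg (snd w)) <= (r1 - r0) * / INR N).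
    { unfold rg. fold (sg (snd x)) (sg (snd w)).
      replace (r0 + (r1 - r0) * sg (snd x) - (r0 + (r1 - r0) * sg (snd w)))
        with ((r1 - r0) * (sg (snd x) - sg (snd w))) by ring.
      rewrite Rabs_mult, (Rabs_pos_eq (r1 - r0)) by lra.
      apply Rmult_le_compat_l; lra. }
    assert (0 < (r1 - r0) * / INR N) by (apply Rmult_lt_0_compat; lra).
    split; [|split]; [| |lra]; apply HG; auto; lra. }
  destruct (Hclose y B3 B4 Hxy) as (Y1 & Y2 & Y3).
  destruct (Hclose z B5 B6 Hxz) as (Z1 & Z2 & Z3).
  apply Hp1 in Hx; auto. apply Hp2 in Hy; auto.
  apply Rabs_lt_between in Y1, Y2, Y3, Z1, Z2, Z3.
  (* At [x] one has [G1 <= 0], at the neighbour [y] one has [G1 >= 0], and the two values differ by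
     less than [e]. The vertices [y] and [z] bound [G2] from below and above in the same way, unless
     they lie on an end row. *)
  exists (sg (fst x)), (rg (snd x)). split; [auto|]. split; [auto|].
  split; [apply Rabs_le_between; lra|]. split.
  - destruct Hy2 as [Hy2 | Hy2].
    + left. unfold q in Hy2. destruct Rle_dec; [lra|discriminate].
    + right. rewrite Hy2 in Y3. replace (rg 0%nat) with r0 in Y3
        by (unfold rg; cbn; field; lra). lra.
  - destruct Hz2 as [Hz2 | Hz2].
    + left. unfold q in Hz2. destruct Rle_dec; [discriminate|lra].
    + right. rewrite Hz2 in Z3. replace (rg N) with r1 in Z3
        by (unfold rg; field; lra). lra.
Qed.

(** * Limits of grid functions *)

Definition nat_floor (x : R) : nat := proj1_sig (nfloor_ex (Rmax x 0) (Rmax_r x 0)).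

Lemma nat_floor_spec (x : R) : 0 <= x -> INR (nat_floor x) <= x < INR (nat_floor x) + 1.
Proof.
  intros Hx. unfold nat_floor. destruct nfloor_ex as [n Hn]; cbn.
  now rewrite Rmax_left in Hn.
Qed.

Lemma nat_floor_INR (n : nat) : nat_floor (INR n) = n.
Proof.
  destruct (nat_floor_spec (INR n) (pos_INR n)) as [H1 H2].
  rewrite <- S_INR in H2. apply INR_le in H1. apply INR_lt in H2. lia.
Qed.

Lemma nat_floor_div (h t : R) : 0 < h -> 0 <= t ->
  INR (nat_floor (t / h)) * h <= t < INR (nat_floor (t / h)) * h + h.
Proof.
  intros Hh Ht.
  destruct (nat_floor_spec (t / h)) as [H1 H2]; [now apply Rdiv_le_0_compat|].
  apply (Rmult_le_compat_r h) in H1; [|lra].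
  apply (Rmult_lt_compat_r h) in H2; [|lra].
  replace (t / h * h) with t in * by (field; lra). lra.
Qed.

(** Here [d] is uniform in [s] while the set of [n] may depend on [s]. This is what allows all steps
    in a short interval to be compared with the value at its left end. *)
Definition grid_approx (U : (nat -> Prop) -> Prop) (h : nat -> R) (T : R)
  (wn : nat -> nat -> R) (w : R -> R) : Prop :=
  forall e, 0 < e -> exists d, 0 < d /\ forall s, 0 <= s <= T ->
    U (fun n => forall k, Rabs (INR k * h n - s) < d -> INR k * h n <= T ->
                Rabs (wn n k - w s) < e).

Definition grid_lim (U : (nat -> Prop) -> Prop) (h : nat -> R) (T : R)
  (wn : nat -> nat -> R) (w : R -> R) : Prop :=
  forall s, 0 <= s <= T ->
    filterlim (fun n => wn n (nat_floor (s / h n))) U (locally (w s)).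

Lemma grid_index_lim (U : (nat -> Prop) -> Prop) (h : nat -> R) (t : R) :
  Filter U -> (forall n, 0 < h n) -> filterlim h U (locally 0) -> 0 <= t ->
  filterlim (fun n => INR (nat_floor (t / h n)) * h n) U (locally t).
Proof.
  intros HF Hh Hh0 Ht. apply filterlim_R_eps; auto. intros eps Heps.
  generalize (proj1 (filterlim_R_eps U _ _ HF) Hh0 eps Heps).
  apply filter_imp. intros n Hn. specialize (Hh n).
  rewrite Rminus_0_r, Rabs_pos_eq in Hn by lra.
  destruct (nat_floor_div (h n) t Hh Ht). apply Rabs_lt_between. lra.
Qed.

Lemma increments_bound (w : nat -> R) (c e : R) (p m : nat) :
  (forall j, (p <= j < p + m)%nat -> Rabs (w (S j) - w j - c) <= e) ->
  Rabs (w (p + m)%nat - w p - INR m * c) <= INR m * e.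
Proof.
  induction m as [|m IH]; intros H.
  - rewrite Nat.add_0_r. cbn. replace (_ - _ - _) with 0 by ring. rewrite Rabs_R0. lra.
  - rewrite Nat.add_succ_r, S_INR.
    replace (_ - _ - _) with ((w (p + m)%nat - w p - INR m * c)
      + (w (S (p + m)) - w (p + m)%nat - c)) by ring.
    eapply Rle_trans; [apply Rabs_triang|].
    specialize (IH ltac:(intros; apply H; lia)).
    specialize (H (p + m)%nat ltac:(lia)). lra.
Qed.

(** Grid functions that are Lipschitz uniformly in [n] are equicontinuous. Once [h n < d], a node
    near [s] is within [2 * d] of the node just before [s], which costs at most
    [C * (2 * d) < e / 2]. *)
Lemma grid_approx_of_bounded_increments (U : (nat -> Prop) -> Prop) (h : nat -> R)
  (T C : R) (wn : nat -> nat -> R) (w : R -> R) :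
  Filter U -> (forall n, 0 < h n) -> filterlim h U (locally 0) -> 0 <= C ->
  (forall n k, INR k * h n <= T -> Rabs (wn n (S k) - wn n k) <= C * h n) ->
  grid_lim U h T wn w -> grid_approx U h T wn w.
Proof.
  intros HU Hh Hh0 HC Hinc Hlim e He.
  assert (Hlip : forall n p m, INR (p + m) * h n <= T ->
    Rabs (wn n (p + m)%nat - wn n p) <= C * Rabs (INR (p + m) * h n - INR p * h n)).
  { intros n p m Hm. specialize (Hh n).
    assert (H := increments_bound (wn n) 0 (C * h n) p m).
    rewrite Rmult_0_r, Rminus_0_r in H.
    rewrite (Rabs_pos_eq (_ - INR p * h n)).
    - rewrite plus_INR.
      replace (C * ((INR p + INR m) * h n - INR p * h n)) with (INR m * (C * h n)) by ring.
      apply H. intros j Hj. rewrite Rminus_0_r. apply Hinc.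
      apply Rle_trans with (2 := Hm). apply Rmult_le_compat_r; [lra|].
      apply le_INR. lia.
    - rewrite plus_INR. assert (0 <= INR m * h n)
        by (apply Rmult_le_pos; [apply pos_INR | lra]). lra. }
  exists (e / (4 * (C + 1))). assert (Hd : 0 < e / (4 * (C + 1)))
    by (apply Rdiv_lt_0_compat; lra).
  set (d := e / (4 * (C + 1))) in *. split; [exact Hd|].
  assert (HCd : C * (2 * d) < e / 2).
  { replace (e / 2) with ((C + 1) * (2 * d)) by (unfold d; field; lra).
    apply Rmult_lt_compat_r; lra. }
  intros s Hs.
  generalize (filter_and _ _ (proj1 (filterlim_R_eps U _ _ HU) Hh0 d Hd)
    (proj1 (filterlim_R_eps U _ _ HU) (Hlim s Hs) (e / 2) ltac:(lra))).
  apply filter_imp. intros n [H1 H2] k Hk HkT. specialize (Hh n).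
  rewrite Rminus_0_r, Rabs_pos_eq in H1 by lra.
  destruct (nat_floor_div (h n) s Hh (proj1 Hs)) as [F1 F2].
  set (k0 := nat_floor (s / h n)) in *.
  assert (Hkk : Rabs (wn n k - wn n k0) <= C * Rabs (INR k * h n - INR k0 * h n)).
  { destruct (Nat.le_ge_cases k0 k) as [Hle | Hle].
    - replace k with (k0 + (k - k0))%nat by lia. apply Hlip.
      replace (k0 + (k - k0))%nat with k by lia. exact HkT.
    - rewrite Rabs_minus_sym, (Rabs_minus_sym (_ * _)).
      replace k0 with (k + (k0 - k))%nat by lia. apply Hlip.
      replace (k + (k0 - k))%nat with k0 by lia. lra. }
  assert (Hdk : Rabs (INR k * h n - INR k0 * h n) <= 2 * d).
  { apply Rabs_lt_between in Hk. apply Rabs_le_between. lra. }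
  apply (Rmult_le_compat_l C) in Hdk; [|lra].
  replace (wn n k - w s) with ((wn n k - wn n k0) + (wn n k0 - w s)) by ring.
  eapply Rle_lt_trans; [apply Rabs_triang|]. lra.
Qed.

(** A function with uniformly vanishing derivative is constant, in a form that presupposes neither
    continuity nor differentiability: add the increments over [N] equal pieces of [[0, t]]. *)
Lemma constant_of_small_increments (Z : R -> R) (T : R) :
  (forall e, 0 < e -> exists d, 0 < d /\ forall s t, 0 <= s -> s <= t -> t <= T ->
     t - s < d -> Rabs (Z t - Z s) <= e * (t - s)) ->
  forall t, 0 <= t <= T -> Z t = Z 0.
Proof.
  intros H t Ht. apply Rminus_diag_uniq, cond_eq. intros eps Heps.
  rewrite Rminus_0_r.
  destruct (H (eps / (t + 1))) as [d [Hd Hs]].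
  { apply Rdiv_lt_0_compat; lra. }
  destruct (archimed_cor1 (d / (t + 1))) as [N [HN HN0]].
  { apply Rdiv_lt_0_compat; lra. }
  assert (HNR : 0 < INR N) by (apply lt_0_INR; lia).
  assert (HiN : 0 < / INR N) by now apply Rinv_0_lt_compat.
  assert (Htd : t * / INR N < d).
  { apply Rle_lt_trans with ((t + 1) * / INR N).
    - apply Rmult_le_compat_r; lra.
    - apply (Rmult_lt_compat_l (t + 1)) in HN; [|lra].
      replace ((t + 1) * (d / (t + 1))) with d in HN by (field; lra). exact HN. }
  assert (Hi : forall i, (i <= N)%nat ->
    Rabs (Z (INR i * (t * / INR N)) - Z 0) <= eps / (t + 1) * (INR i * (t * / INR N))).
  { intros i. induction i as [|i IH]; intros Hi.
    - cbn. rewrite !Rmult_0_l, Rminus_diag, Rabs_R0. lra.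
    - specialize (IH ltac:(lia)). rewrite S_INR.
      assert (0 <= t * / INR N) by (apply Rmult_le_pos; lra).
      assert (Hpi := pos_INR i).
      assert (Hb : (INR i + 1) * (t * / INR N) <= T).
      { apply le_INR in Hi. rewrite S_INR in Hi.
        apply Rle_trans with (INR N * (t * / INR N)).
        - now apply Rmult_le_compat_r.
        - replace (INR N * (t * / INR N)) with t by (field; lra). lra. }
      specialize (Hs (INR i * (t * / INR N)) ((INR i + 1) * (t * / INR N))
        ltac:(nra) ltac:(nra) Hb ltac:(lra)).
      replace (Z _ - Z 0) with ((Z ((INR i + 1) * (t * / INR N)) - Z (INR i * (t * / INR N)))
        + (Z (INR i * (t * / INR N)) - Z 0)) by ring.
      eapply Rle_trans; [apply Rabs_triang|]. lra. }
  specialize (Hi N (le_n _)).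
  replace (INR N * (t * / INR N)) with t in Hi by (field; lra).
  apply (Rle_lt_trans _ _ _ Hi).
  replace eps with (eps / (t + 1) * (t + 1)) at 2 by (field; lra).
  apply Rmult_lt_compat_l; [|lra]. apply Rdiv_lt_0_compat; lra.
Qed.

(** The difference [w - W] has increments that are small relative to their length. Over a short
    interval the increment of [W], by the mean value theorem, and that of [w], as a limit of sums of
    steps, both differ from [(t - s) * c s] by at most [e / 2 * (t - s)]. *)
Lemma grid_lim_primitive (U : (nat -> Prop) -> Prop) (h : nat -> R)
  (T : R) (wn cn : nat -> nat -> R) (w c W : R -> R) :
  ProperFilter U -> (forall n, 0 < h n) -> filterlim h U (locally 0) ->
  (forall n k, wn n (S k) = wn n k + h n * cn n k) ->
  grid_lim U h T wn w -> grid_approx U h T cn c ->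
  (forall t, continuous c t) -> (forall t, is_derive W t (c t)) ->
  forall t, 0 <= t <= T -> w t = w 0 + (W t - W 0).
Proof.
  intros HU Hh Hh0 Hstep Hlim Happ Hc HW.
  assert (HF : Filter U) by apply HU.
  assert (HZ := constant_of_small_increments (fun t => w t - W t) T).
  cbv beta in HZ. enough (H : forall e, 0 < e -> exists d, 0 < d /\
    forall s t, 0 <= s -> s <= t -> t <= T -> t - s < d ->
    Rabs (w t - W t - (w s - W s)) <= e * (t - s)).
  { intros t Ht. specialize (HZ H t Ht). lra. }
  intros e He.
  destruct (Happ (e / 2) ltac:(lra)) as [d1 [Hd1 Ha]].
  assert (Hd2 : exists d2, 0 < d2 /\ forall x y, 0 <= x <= T -> 0 <= y <= T ->
    Rabs (y - x) < d2 -> Rabs (c y - c x) < e / 2).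
  { destruct (unifcont_1d c 0 T (fun x _ => Hc x) (mkposreal (e / 2) ltac:(lra)))
      as [[d2 Hd2] Hu].
    exists d2. split; [exact Hd2|]. intros x y Hx Hy Hxy. apply NNPP.
    exact (Hu x y Hx Hy Hxy). }
  destruct Hd2 as [d2 [Hd2 Hu]].
  exists (Rmin d1 d2). split; [now apply Rmin_glb_lt|].
  intros s t Hs Hst Ht Hd.
  assert (D1 := Rlt_le_trans _ _ _ Hd (Rmin_l d1 d2)).
  assert (D2 := Rlt_le_trans _ _ _ Hd (Rmin_r d1 d2)).
  assert (E1 : Rabs (W t - W s - (t - s) * c s) <= e / 2 * (t - s)).
  { destruct (MVT_gen W s t c) as [x [Hx Heq]].
    - intros; apply HW.
    - intros x _. apply continuity_pt_filterlim.
      apply (ex_derive_continuous W). eexists; apply HW.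
    - rewrite Rmin_left, Rmax_right in Hx by lra. rewrite Heq.
      replace (_ - _) with ((c x - c s) * (t - s)) by ring.
      rewrite Rabs_mult, (Rabs_pos_eq (t - s)) by lra.
      apply Rmult_le_compat_r; [lra|]. left. apply Hu; try lra.
      rewrite Rabs_pos_eq; lra. }
  assert (E2 : Rabs (w t - w s - (t - s) * c s) <= e / 2 * (t - s)).
  { assert (Hk : forall r, 0 <= r <= T ->
      filterlim (fun n => INR (nat_floor (r / h n)) * h n) U (locally r)).
    { intros r Hr. apply grid_index_lim; auto. lra. }
    set (ks := fun n => nat_floor (s / h n)). set (kt := fun n => nat_floor (t / h n)).
    set (dk := fun n => INR (kt n) * h n - INR (ks n) * h n).
    assert (Ldk : filterlim dk U (locally (t - s)))
      by (apply filterlim_R_minus; auto; apply Hk; lra).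
    assert (Lw : filterlim (fun n => wn n (kt n) - wn n (ks n) - dk n * c s) U
       (locally (w t - w s - (t - s) * c s))).
    { apply filterlim_R_minus; auto.
      - apply filterlim_R_minus; auto; apply Hlim; lra.
      - apply filterlim_R_mult; auto. apply filterlim_const. }
    assert (Hev : U (fun n => Rabs (wn n (kt n) - wn n (ks n) - dk n * c s)
                              <= e / 2 * dk n)).
    { generalize (filter_and _ _ (proj1 (filterlim_R_eps U _ _ HF) Hh0 d1 Hd1)
        (Ha s ltac:(lra))).
      apply filter_imp. intros n [Hn1 Hn2]. specialize (Hh n).
      rewrite Rminus_0_r, Rabs_pos_eq in Hn1 by lra.
      destruct (nat_floor_div (h n) s Hh Hs) as [S1 S2].
      destruct (nat_floor_div (h n) t Hh ltac:(lra)) as [T1 T2].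
      fold (ks n) in S1, S2. fold (kt n) in T1, T2.
      assert (Hle : (ks n <= kt n)%nat).
      { assert (L : INR (ks n) < INR (kt n) + 1).
        { apply Rmult_lt_reg_r with (h n); auto. lra. }
        rewrite <- S_INR in L. apply INR_lt in L. lia. }
      assert (I := increments_bound (wn n) (h n * c s) (h n * (e / 2)) (ks n) (kt n - ks n)).
      replace (ks n + (kt n - ks n))%nat with (kt n) in I by lia.
      rewrite minus_INR in I by exact Hle. unfold dk.
      replace ((INR (kt n) * h n - INR (ks n) * h n) * c s)
        with ((INR (kt n) - INR (ks n)) * (h n * c s)) by ring.
      replace (e / 2 * (INR (kt n) * h n - INR (ks n) * h n))
        with ((INR (kt n) - INR (ks n)) * (h n * (e / 2))) by ring.
      apply I. intros j Hj. rewrite Hstep.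
      replace (_ - _) with (h n * (cn n j - c s)) by ring.
      rewrite Rabs_mult, (Rabs_pos_eq (h n)) by lra.
      apply Rmult_le_compat_l; [lra|]. left.
      assert (J1 : INR (ks n) * h n <= INR j * h n)
        by (apply Rmult_le_compat_r; [lra | apply le_INR; lia]).
      assert (J2 : INR (S j) * h n <= INR (kt n) * h n)
        by (apply Rmult_le_compat_r; [lra | apply le_INR; lia]).
      rewrite S_INR in J2.
      apply Hn2; [|lra]. apply Rabs_lt_between. lra. }
    apply Rabs_le_between. split.
    - apply (filterlim_R_le U (fun n => - (e / 2) * dk n) _ (- (e / 2 * (t - s))) _ HU) with (2 := Lw).
      + replace (- (e / 2 * (t - s))) with (- (e / 2) * (t - s)) by ring.
        now apply filterlim_R_scal.
      + revert Hev. apply filter_imp. intros n Hn. apply Rabs_le_between in Hn. lra.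
    - apply (filterlim_R_le U _ (fun n => e / 2 * dk n) _ _ HU) with (1 := Lw).
      + now apply filterlim_R_scal.
      + revert Hev. apply filter_imp. intros n Hn. apply Rabs_le_between in Hn. lra. }
  replace (_ - _) with ((w t - w s - (t - s) * c s) - (W t - W s - (t - s) * c s)) by ring.
  apply Rabs_le_between in E1, E2. apply Rabs_le_between. lra.
Qed.

(** * The Euler scheme *)

(* Explicit Euler scheme for [u' = v, v' = - g t u, s' = Rmax u 0]. *)
Fixpoint euler (g : R -> R -> R) (h A B : R) (k : nat) : R * R * R :=
  match k with
  | O => (A, B, 0)
  | S k =>
      let '(u, v, s) := euler g h A B k in
      (u + h * v, v - h * g (INR k * h) u, s + h * Rmax u 0)
  end.

Definition euler_u g h A B k : R := fst (fst (euler g h A B k)).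
Definition euler_v g h A B k : R := snd (fst (euler g h A B k)).
Definition euler_s g h A B k : R := snd (euler g h A B k).

Lemma euler_u_S g h A B k :
  euler_u g h A B (S k) = euler_u g h A B k + h * euler_v g h A B k.
Proof. unfold euler_u, euler_v. cbn. now destruct (euler g h A B k) as [[u v] s]. Qed.

Lemma euler_v_S g h A B k :
  euler_v g h A B (S k)
  = euler_v g h A B k - h * g (INR k * h) (euler_u g h A B k).
Proof. unfold euler_u, euler_v. cbn. now destruct (euler g h A B k) as [[u v] s]. Qed.

Lemma euler_s_S g h A B k :
  euler_s g h A B (S k) = euler_s g h A B k + h * Rmax (euler_u g h A B k) 0.
Proof. unfold euler_u, euler_s. cbn. now destruct (euler g h A B k) as [[u v] s]. Qed.

(** Continuous dependence on the initial data, which can fail for the exact flow. For a fixed number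
    of steps the scheme is a composition of uniformly continuous maps; [d] may depend on [h] and
    [k]. *)
Lemma euler_unif_cont (g : R -> R -> R) (h : R) (k : nat) :
  0 < h ->
  (forall e, 0 < e -> exists d, 0 < d /\
     forall t x x', Rabs (x - x') < d -> Rabs (g t x - g t x') < e) ->
  forall e, 0 < e -> exists d, 0 < d /\
    forall A A' B B', Rabs (A - A') < d -> Rabs (B - B') < d ->
      Rabs (euler_u g h A B k - euler_u g h A' B' k) < e /\
      Rabs (euler_v g h A B k - euler_v g h A' B' k) < e /\
      Rabs (euler_s g h A B k - euler_s g h A' B' k) < e.
Proof.
  intros Hh Hg. induction k as [|k IH]; intros e He.
  - exists e. split; [exact He|]. intros A A' B B' HA HB. cbn.
    rewrite Rminus_diag, Rabs_R0. auto.
  - destruct (Hg (e / (2 * (1 + h)))) as [d1 [Hd1 H1]].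
    { apply Rdiv_lt_0_compat; lra. }
    destruct (IH (Rmin d1 (e / (2 * (1 + h))))) as [d [Hd H]].
    { apply Rmin_glb_lt; [exact Hd1 | apply Rdiv_lt_0_compat; lra]. }
    exists d. split; [exact Hd|]. intros A A' B B' HA HB.
    destruct (H A A' B B' HA HB) as (Hu & Hv & Hs).
    rewrite !euler_u_S, !euler_v_S, !euler_s_S.
    assert (Hgu := H1 (INR k * h) _ _ (Rlt_le_trans _ _ _ Hu (Rmin_l _ _))).
    apply (fun H => Rlt_le_trans _ _ _ H (Rmin_r _ _)) in Hu, Hv, Hs.
    assert (Hm := Rmax0_lipschitz (euler_u g h A B k) (euler_u g h A' B' k)).
    set (e' := e / (2 * (1 + h))) in *.
    assert (He' : e' + h * e' < e).
    { replace (e' + h * e') with (e / 2) by (unfold e'; field; lra). lra. }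
    assert (Hlin : forall x y, Rabs x < e' -> Rabs y < e' -> Rabs (x + h * y) < e).
    { intros x y Hx Hy. eapply Rle_lt_trans; [apply Rabs_triang|].
      rewrite Rabs_mult, (Rabs_pos_eq h) by lra.
      assert (h * Rabs y <= h * e') by (apply Rmult_le_compat_l; lra). lra. }
    split; [|split].
    + replace (_ - _) with ((euler_u g h A B k - euler_u g h A' B' k)
        + h * (euler_v g h A B k - euler_v g h A' B' k)) by ring. auto.
    + replace (_ - _) with ((euler_v g h A B k - euler_v g h A' B' k)
        + h * - (g (INR k * h) (euler_u g h A B k) - g (INR k * h) (euler_u g h A' B' k)))
        by ring.
      apply Hlin; auto. now rewrite Rabs_Ropp.
    + replace (_ - _) with ((euler_s g h A B k - euler_s g h A' B' k)
        + h * (Rmax (euler_u g h A B k) 0 - Rmax (euler_u g h A' B' k) 0)) by ring.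
      apply Hlin; auto. lra.
Qed.

(** Discrete form of a concave function lying below its tangent at 0: the slopes [euler_v] can only
    decrease. *)
Lemma euler_le_tangent (g : R -> R -> R) (h A B : R) (k : nat) :
  0 < h -> (forall t x, 0 <= g t x) ->
  euler_v g h A B k <= B /\ euler_u g h A B k <= A + B * (INR k * h).
Proof.
  intros Hh Hg. induction k as [|k [IHv IHu]].
  - cbn. lra.
  - rewrite euler_u_S, euler_v_S, S_INR.
    specialize (Hg (INR k * h) (euler_u g h A B k)). split; nra.
Qed.

Lemma euler_bounds (g : R -> R -> R) (h A B T Y CA CB : R) (k : nat) :
  0 < h -> 0 <= T -> 0 <= CA -> 0 <= CB ->
  (forall t x, Rabs (g t x) <= Y) -> Rabs A <= CA -> Rabs B <= CB ->
  INR k * h <= T ->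
  Rabs (euler_v g h A B k) <= CB + T * Y /\
  Rabs (euler_u g h A B k) <= CA + T * (CB + T * Y) /\
  Rabs (euler_s g h A B k) <= T * (CA + T * (CB + T * Y)).
Proof.
  intros Hh HT HCA HCB HY HA HB.
  assert (HY0 : 0 <= Y) by (eapply Rle_trans; [apply Rabs_pos | apply (HY 0 0)]).
  (* The induction needs the elapsed time [INR k * h] as the outer factor; the inner bounds may
     already use [T]. *)
  enough (H : INR k * h <= T ->
    Rabs (euler_v g h A B k) <= CB + INR k * h * Y /\
    Rabs (euler_u g h A B k) <= CA + INR k * h * (CB + T * Y) /\
    Rabs (euler_s g h A B k) <= INR k * h * (CA + T * (CB + T * Y))).
  { intros HkT. destruct (H HkT) as (H1 & H2 & H3).
    assert (0 <= INR k * h) by (apply Rmult_le_pos; [apply pos_INR | lra]).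
    assert (0 <= T * Y) by (now apply Rmult_le_pos).
    assert (0 <= T * (CB + T * Y)) by (apply Rmult_le_pos; lra).
    split; [|split].
    - eapply Rle_trans; [exact H1|]. apply Rplus_le_compat_l, Rmult_le_compat_r; lra.
    - eapply Rle_trans; [exact H2|]. apply Rplus_le_compat_l, Rmult_le_compat_r; lra.
    - eapply Rle_trans; [exact H3|]. apply Rmult_le_compat_r; lra. }
  induction k as [|k IH]; intros HkT.
  - cbn. rewrite Rabs_R0, !Rmult_0_l. lra.
  - rewrite S_INR in HkT |- *.
    assert (Hk0 : 0 <= INR k * h) by (apply Rmult_le_pos; [apply pos_INR | lra]).
    destruct (IH ltac:(lra)) as (H1 & H2 & H3).
    assert (0 <= T * Y) by (now apply Rmult_le_pos).
    assert (HkY : INR k * h * Y <= T * Y) by (apply Rmult_le_compat_r; lra).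
    assert (HkL : INR k * h * (CB + T * Y) <= T * (CB + T * Y))
      by (apply Rmult_le_compat_r; lra).
    rewrite euler_u_S, euler_v_S, euler_s_S.
    specialize (HY (INR k * h) (euler_u g h A B k)).
    assert (Hlin : forall x y b c, Rabs x <= b -> Rabs y <= c -> Rabs (x + h * y) <= b + h * c).
    { intros x y b c Hx Hy. eapply Rle_trans; [apply Rabs_triang|].
      rewrite (Rabs_mult h), (Rabs_pos_eq h) by lra.
      assert (h * Rabs y <= h * c) by (apply Rmult_le_compat_l; lra). lra. }
    split; [|split].
    + replace (euler_v g h A B k - h * g (INR k * h) (euler_u g h A B k))
        with (euler_v g h A B k + h * - g (INR k * h) (euler_u g h A B k)) by ring.
      eapply Rle_trans; [apply Hlin with (1 := H1) (c := Y)|].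
      * now rewrite Rabs_Ropp.
      * lra.
    + eapply Rle_trans; [apply Hlin with (1 := H2) (c := CB + T * Y)|]; lra.
    + eapply Rle_trans;
        [apply Hlin with (1 := H3) (c := CA + T * (CB + T * Y))|]; [|lra].
      assert (Hm := Rmax0_lipschitz (euler_u g h A B k) 0).
      rewrite (Rmax_left 0 0), !Rminus_0_r in Hm by lra. lra.
Qed.

(** * Peano's existence theorem along an ultrafilter *)

Lemma grid_lim_exists (U : (nat -> Prop) -> Prop) (h : nat -> R) (T C : R)
  (wn : nat -> nat -> R) :
  ProperFilter U -> (forall P, U P \/ U (fun n => ~ P n)) -> (forall n, 0 < h n) ->
  (forall n k, INR k * h n <= T -> Rabs (wn n k) <= C) ->
  exists w, grid_lim U h T wn w.
Proof.
  intros HU Hult Hh Hb.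
  destruct (functional_choice (fun s l => 0 <= s <= T ->
    filterlim (fun n => wn n (nat_floor (s / h n))) U (locally l))) as [w Hw].
  - intros s. destruct (classic (0 <= s <= T)) as [Hs | Hs].
    + destruct (bounded_ultralimit U (fun n => wn n (nat_floor (s / h n))) C HU Hult)
        as [l Hl]; [|now exists l].
      apply filter_forall. intros n. apply Hb.
      destruct (nat_floor_div (h n) s (Hh n) (proj1 Hs)). lra.
    + exists 0. tauto.
  - now exists w.
Qed.

(** Composition with [clamp] extends data on [[0, T]] to continuous functions on the whole line, so
    that derivatives and integrals need no care at the endpoints. *)
Definition clamp (T t : R) : R := Rmax 0 (Rmin t T).

Lemma clamp_range (T t : R) : 0 <= T -> 0 <= clamp T t <= T.
Proof. intros. unfold clamp, Rmax, Rmin. destruct (Rle_dec t T), Rle_dec; lra. Qed.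

Lemma clamp_id (T t : R) : 0 <= t <= T -> clamp T t = t.
Proof. intros. unfold clamp. rewrite Rmin_left, Rmax_right; lra. Qed.

Lemma clamp_lipschitz (T s t : R) :
  0 <= T -> Rabs (clamp T t - clamp T s) <= Rabs (t - s).
Proof.
  intros. unfold clamp, Rmax, Rmin.
  destruct (Rle_dec t T), (Rle_dec s T); repeat destruct Rle_dec;
    unfold Rabs; repeat destruct Rcase_abs; lra.
Qed.

Lemma is_derive_primitive_from_0 (y : R -> R) (t : R) :
  (forall x, continuous y x) -> is_derive (RInt y 0) t (y t).
Proof.
  intros Hy. apply (is_derive_RInt y (RInt y 0) 0 t); [|apply Hy].
  apply filter_forall. intros x. apply (RInt_correct y 0 x).
  apply ex_RInt_continuous. intros; apply Hy.
Qed.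

(** Peano's theorem with Euler polygons. The solution also has to remain the limit of its own
    polygons, since the approximate boundary conditions are known only for them. *)
Lemma euler_limit (U : (nat -> Prop) -> Prop) (g : R -> R -> R) (h An Bn : nat -> R)
  (T Y CA CB A B : R) :
  ProperFilter U -> (forall P, U P \/ U (fun n => ~ P n)) ->
  (forall n, 0 < h n) -> filterlim h U (locally 0) -> 0 < T ->
  (forall t x, 0 <= g t x <= Y) ->
  (forall e, 0 < e -> exists d, 0 < d /\ forall t t' x x',
     Rabs (t - t') < d -> Rabs (x - x') < d -> Rabs (g t x - g t' x') < e) ->
  (forall n, Rabs (An n) <= CA) -> (forall n, Rabs (Bn n) <= CB) ->
  filterlim An U (locally A) -> filterlim Bn U (locally B) ->
  exists u v y : R -> R,
    (forall t, is_derive u t (v t)) /\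
    (forall t, is_derive v t (- y t)) /\
    (forall t, continuous y t) /\
    (forall t, 0 <= y t) /\
    (forall t, 0 <= t <= T -> y t = g t (u t)) /\
    u 0 = A /\ v 0 = B /\
    grid_lim U h T (fun n => euler_u g (h n) (An n) (Bn n)) u /\
    grid_lim U h T (fun n => euler_s g (h n) (An n) (Bn n))
      (RInt (fun s => Rmax (u s) 0) 0).
Proof.
  intros HU Hult Hh Hh0 HT Hg Huc HCA HCB HA HB.
  assert (HF : Filter U) by apply HU.
  assert (HgY : forall t x, Rabs (g t x) <= Y).
  { intros t x. rewrite Rabs_pos_eq; apply Hg. }
  assert (HY0 : 0 <= Y) by (eapply Rle_trans; [apply Rabs_pos | apply (HgY 0 0)]).
  assert (HCA0 : 0 <= CA) by (eapply Rle_trans; [apply Rabs_pos | apply (HCA 0%nat)]).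
  assert (HCB0 : 0 <= CB) by (eapply Rle_trans; [apply Rabs_pos | apply (HCB 0%nat)]).
  set (L := CB + T * Y). set (M := CA + T * L).
  assert (HL0 : 0 <= L) by (assert (0 <= T * Y) by (apply Rmult_le_pos; lra); unfold L; lra).
  assert (HM0 : 0 <= M) by (assert (0 <= T * L) by (apply Rmult_le_pos; lra); unfold M; lra).
  set (un := fun n => euler_u g (h n) (An n) (Bn n)).
  set (vn := fun n => euler_v g (h n) (An n) (Bn n)).
  set (sn := fun n => euler_s g (h n) (An n) (Bn n)).
  assert (Hb : forall n k, INR k * h n <= T ->
    Rabs (vn n k) <= L /\ Rabs (un n k) <= M /\ Rabs (sn n k) <= T * M).
  { intros n k Hk. apply euler_bounds; auto; lra. }
  destruct (grid_lim_exists U h T M un) as [u0 Hu0]; auto.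
  { intros n k Hk. now apply Hb. }
  destruct (grid_lim_exists U h T L vn) as [v0 Hv0]; auto.
  { intros n k Hk. now apply Hb. }
  destruct (grid_lim_exists U h T (T * M) sn) as [s0 Hs0]; auto.
  { intros n k Hk. now apply Hb. }
  assert (Hinit : forall (wn : nat -> nat -> R) w (xn : nat -> R) x,
    grid_lim U h T wn w -> (forall n, wn n 0%nat = xn n) ->
    filterlim xn U (locally x) -> w 0 = x).
  { intros wn w xn x Hw Hx Hlim.
    apply (filterlim_locally_unique (F := U) xn); [|exact Hlim].
    apply (filterlim_ext (fun n => wn n (nat_floor (0 / h n)))); [|apply Hw; lra].
    intros n. rewrite <- Hx. f_equal.
    replace (0 / h n) with (INR 0) by (specialize (Hh n); cbn; field; lra).
    apply nat_floor_INR. }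
  assert (Iu : u0 0 = A) by (apply (Hinit un u0 An); auto).
  assert (Iv : v0 0 = B) by (apply (Hinit vn v0 Bn); auto).
  assert (Is : s0 0 = 0).
  { apply (Hinit sn s0 (fun _ => 0)); auto. apply filterlim_const. }
  assert (Au : grid_approx U h T un u0).
  { apply (grid_approx_of_bounded_increments U h T L); auto.
    intros n k Hk. unfold un. rewrite euler_u_S. fold (un n) (vn n).
    replace (_ - _) with (h n * vn n k) by (unfold vn; ring).
    specialize (Hh n). rewrite Rabs_mult, (Rabs_pos_eq (h n)), Rmult_comm by lra.
    apply Rmult_le_compat_r; [lra | now apply Hb]. }
  assert (Av : grid_approx U h T vn v0).
  { apply (grid_approx_of_bounded_increments U h T Y); auto.
    intros n k Hk. unfold vn. rewrite euler_v_S.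
    replace (_ - _) with (h n * - g (INR k * h n) (un n k)) by (unfold un; ring).
    specialize (Hh n). rewrite Rabs_mult, (Rabs_pos_eq (h n)), Rmult_comm, Rabs_Ropp by lra.
    apply Rmult_le_compat_r; [lra | apply HgY]. }
  (* The Lipschitz bound of the polygons survives in the limit and makes [y] below continuous. *)
  assert (Lu0 : forall s t, 0 <= s <= T -> 0 <= t <= T -> s <= t ->
     Rabs (u0 t - u0 s) <= L * (t - s)).
  { intros s t Hs Ht Hst.
    set (k := fun n r => nat_floor (r / h n)).
    assert (Hk : forall r, 0 <= r <= T ->
      filterlim (fun n => INR (k n r) * h n) U (locally r)).
    { intros r Hr. apply grid_index_lim; auto. lra. }
    apply (filterlim_R_le U (fun n => Rabs (un n (k n t) - un n (k n s)))
      (fun n => L * (INR (k n t) * h n - INR (k n s) * h n)) _ _ HU).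
    - apply (filterlim_comp _ _ _ _ Rabs U _ _
        (filterlim_R_minus U _ _ _ _ HF (Hu0 t Ht) (Hu0 s Hs))).
      apply (continuous_Rabs (u0 t - u0 s)).
    - apply filterlim_R_scal; auto. apply filterlim_R_minus; auto.
    - apply filter_forall. intros n. specialize (Hh n).
      destruct (nat_floor_div (h n) s Hh (proj1 Hs)) as [S1 S2].
      destruct (nat_floor_div (h n) t Hh (proj1 Ht)) as [T1 T2].
      fold (k n s) in S1, S2. fold (k n t) in T1, T2.
      assert (Hle : (k n s <= k n t)%nat).
      { assert (Q : INR (k n s) < INR (k n t) + 1).
        { apply Rmult_lt_reg_r with (h n); auto. lra. }
        rewrite <- S_INR in Q. apply INR_lt in Q. lia. }
      assert (I := increments_bound (un n) 0 (h n * L) (k n s) (k n t - k n s)).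
      replace (k n s + (k n t - k n s))%nat with (k n t) in I by lia.
      rewrite minus_INR, Rmult_0_r, Rminus_0_r in I by exact Hle.
      replace (L * _) with ((INR (k n t) - INR (k n s)) * (h n * L)) by ring.
      apply I. intros j Hj. unfold un. rewrite euler_u_S, Rminus_0_r.
      replace (_ - _) with (h n * vn n j) by (unfold vn; ring).
      rewrite Rabs_mult, (Rabs_pos_eq (h n)) by lra.
      apply Rmult_le_compat_l; [lra|]. apply Hb.
      apply Rle_trans with (INR (k n t) * h n); [|lra].
      apply Rmult_le_compat_r; [lra | apply le_INR; lia]. }
  (* The limit [u0] is controlled on [[0, T]] only, so it is frozen outside. *)
  set (y := fun t => g t (u0 (clamp T t))).
  assert (Hy : forall t, continuous y t).
  { intros t. apply (filterlim_locally (F := locally t)). intros [e He].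
    destruct (Huc e He) as [d [Hd Hgd]].
    assert (Hd' : 0 < d / (L + 1)) by (apply Rdiv_lt_0_compat; lra).
    exists (mkposreal (Rmin d (d / (L + 1))) (Rmin_glb_lt _ _ _ Hd Hd')).
    intros z Hz. change (Rabs (z - t) < Rmin d (d / (L + 1))) in Hz.
    change (Rabs (y z - y t) < e).
    assert (Z1 := Rlt_le_trans _ _ _ Hz (Rmin_l _ _)).
    assert (Z2 := Rlt_le_trans _ _ _ Hz (Rmin_r _ _)).
    apply Hgd; [exact Z1|].
    assert (Hcl := clamp_lipschitz T t z ltac:(lra)).
    assert (R1 := clamp_range T t ltac:(lra)). assert (R2 := clamp_range T z ltac:(lra)).
    assert (Hlip : Rabs (u0 (clamp T z) - u0 (clamp T t))
                   <= L * Rabs (clamp T z - clamp T t)).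
    { destruct (Rle_dec (clamp T t) (clamp T z)).
      - rewrite (Rabs_pos_eq (_ - clamp T t)) by lra. now apply Lu0.
      - rewrite Rabs_minus_sym, (Rabs_minus_sym (clamp T z)),
          (Rabs_pos_eq (_ - clamp T z)) by lra. apply Lu0; lra. }
    apply (Rle_lt_trans _ _ _ Hlip).
    apply Rle_lt_trans with (L * (d / (L + 1))).
    - apply Rmult_le_compat_l; lra.
    - apply Rlt_le_trans with ((L + 1) * (d / (L + 1))).
      + apply Rmult_lt_compat_r; lra.
      + right. field. lra. }
  (* Iterated primitives of [y] are differentiable everywhere; [Ev] and [Eu] identify them with the
     limits [v0] and [u0] on [[0, T]]. *)
  set (v := fun t => B - RInt y 0 t). set (u := fun t => A + RInt v 0 t).
  assert (Dv : forall t, is_derive v t (- y t)).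
  { intros t. replace (- y t) with (0 - y t) by ring.
    apply (is_derive_minus (fun _ => B) (RInt y 0) t 0 (y t)).
    - apply (is_derive_const B t).
    - now apply is_derive_primitive_from_0. }
  assert (Cv : forall t, continuous v t).
  { intros t. apply (ex_derive_continuous v). eexists; apply Dv. }
  assert (Du : forall t, is_derive u t (v t)).
  { intros t. replace (v t) with (0 + v t) by ring.
    apply (is_derive_plus (fun _ => A) (RInt v 0) t 0 (v t)).
    - apply (is_derive_const A t).
    - now apply is_derive_primitive_from_0. }
  assert (Cu : forall t, continuous u t).
  { intros t. apply (ex_derive_continuous u). eexists; apply Du. }
  assert (Ev : forall t, 0 <= t <= T -> v0 t = v t).
  { intros t Ht.
    rewrite (grid_lim_primitive U h T vn (fun n k => - g (INR k * h n) (un n k))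
      v0 (fun t => - y t) v HU Hh Hh0) with (t := t); auto.
    - rewrite Iv. unfold v. rewrite RInt_point. cbn. ring.
    - intros n k. unfold vn. rewrite euler_v_S. unfold un. ring.
    - intros e He. destruct (Huc e He) as [d [Hd Hgd]].
      destruct (Au d Hd) as [d' [Hd' Ha]].
      exists (Rmin d d'). split; [now apply Rmin_glb_lt|].
      intros s Hs. generalize (Ha s Hs). apply filter_imp.
      intros n Hn k Hk HkT.
      replace (_ - _) with (- (g (INR k * h n) (un n k) - y s)) by ring.
      rewrite Rabs_Ropp. unfold y. rewrite clamp_id by lra. apply Hgd.
      + apply (Rlt_le_trans _ _ _ Hk (Rmin_l _ _)).
      + apply Hn; auto. apply (Rlt_le_trans _ _ _ Hk (Rmin_r _ _)).
    - intros s. apply (continuous_opp y). apply Hy. }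
  assert (Eu : forall t, 0 <= t <= T -> u0 t = u t).
  { intros t Ht.
    rewrite (grid_lim_primitive U h T un vn u0 v u HU Hh Hh0) with (t := t); auto.
    - rewrite Iu. unfold u. rewrite RInt_point. cbn. ring.
    - intros n k. apply euler_u_S.
    - intros e He. destruct (Av e He) as [d [Hd Ha]]. exists d. split; [exact Hd|].
      intros s Hs. rewrite <- Ev by lra. now apply Ha. }
  assert (Es : forall t, 0 <= t <= T -> s0 t = RInt (fun s => Rmax (u s) 0) 0 t).
  { assert (Cm : forall t, continuous (fun s => Rmax (u s) 0) t).
    { intros t. apply (continuous_comp u (fun z => Rmax z 0)); [apply Cu|].
      apply continuous_Rmax0. }
    intros t Ht.
    rewrite (grid_lim_primitive U h T sn (fun n k => Rmax (un n k) 0)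
      s0 (fun s => Rmax (u s) 0) (RInt (fun s => Rmax (u s) 0) 0) HU Hh Hh0)
      with (t := t); auto.
    - rewrite Is, RInt_point. cbn. ring.
    - intros n k. apply euler_s_S.
    - intros e He. destruct (Au e He) as [d [Hd Ha]]. exists d. split; [exact Hd|].
      intros s Hs. generalize (Ha s Hs). apply filter_imp. intros n Hn k Hk HkT.
      rewrite <- Eu by lra.
      apply (Rle_lt_trans _ _ _ (Rmax0_lipschitz _ _)). now apply Hn.
    - intros s. exact (is_derive_primitive_from_0 _ s Cm). }
  exists u, v, y.
  split; [exact Du|]. split; [exact Dv|]. split; [exact Hy|].
  split; [intros t; apply Hg|].
  split; [intros t Ht; unfold y; rewrite clamp_id, Eu by lra; reflexivity|].
  split; [unfold u; rewrite RInt_point; cbn; ring|].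
  split; [unfold v; rewrite RInt_point; cbn; ring|].
  split; intros s Hs.
  - rewrite <- Eu by lra. now apply Hu0.
  - rewrite <- Es by lra. now apply Hs0.
Qed.

(** * Concave solutions *)

(** The nonlinearity is left out: [y] stands for [- u''], and its sign yields all the concavity
    estimates. *)
Definition concave_sol (u v y : R -> R) : Prop :=
  (forall t, is_derive u t (v t)) /\ (forall t, is_derive v t (- y t)) /\
  (forall t, continuous y t) /\ (forall t, 0 <= y t).

Lemma is_derive_increment (u v : R -> R) (a b : R) :
  (forall t, is_derive u t (v t)) -> a <= b ->
  exists x, a <= x <= b /\ u b - u a = v x * (b - a).
Proof.
  intros Du Hab. destruct (MVT_gen u a b v) as [x [Hx E]].
  - intros; apply Du.
  - intros x _. apply continuity_pt_filterlim, (ex_derive_continuous u).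
    eexists; apply Du.
  - rewrite Rmin_left, Rmax_right in Hx by lra. now exists x.
Qed.

Lemma is_derive_nondecreasing (u v : R -> R) (a b : R) :
  (forall t, is_derive u t (v t)) -> a <= b ->
  (forall t, a <= t <= b -> 0 <= v t) -> u a <= u b.
Proof.
  intros Du Hab Hv. destruct (is_derive_increment u v a b Du Hab) as [x [Hx E]].
  specialize (Hv x Hx). nra.
Qed.

Lemma concave_sol_slope (u v y : R -> R) (a b : R) :
  concave_sol u v y -> a <= b -> v b <= v a.
Proof.
  intros (_ & Dv & _ & Hy) Hab.
  destruct (is_derive_increment v (fun t => - y t) a b Dv Hab) as [x [Hx E]].
  specialize (Hy x). nra.
Qed.

(** Comparison of the mean slopes on both sides of [b], cleared of denominators so that the points
    may coincide. *)
Lemma concave_sol_chord (u v y : R -> R) (a b c : R) :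
  concave_sol u v y -> a <= b -> b <= c ->
  (c - b) * u a + (b - a) * u c <= (c - a) * u b.
Proof.
  intros H Hab Hbc. assert (Du := proj1 H).
  destruct (is_derive_increment u v a b Du Hab) as [x [Hx E1]].
  destruct (is_derive_increment u v b c Du Hbc) as [z [Hz E2]].
  assert (Hv := concave_sol_slope u v y x z H ltac:(lra)).
  assert (P : 0 <= (c - b) * (b - a)) by (apply Rmult_le_pos; lra).
  replace (u a) with (u b - v x * (b - a)) by lra.
  replace (u c) with (u b + v z * (c - b)) by lra.
  assert (0 <= (v x - v z) * ((c - b) * (b - a))) by (apply Rmult_le_pos; lra).
  nra.
Qed.

Lemma concave_sol_tangent (u v y : R -> R) (a b : R) :
  concave_sol u v y -> a <= b ->
  u b <= u a + v a * (b - a) /\ u a + v b * (b - a) <= u b.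
Proof.
  intros H Hab.
  destruct (is_derive_increment u v a b (proj1 H) Hab) as [x [Hx E]].
  assert (H1 := concave_sol_slope u v y a x H ltac:(lra)).
  assert (H2 := concave_sol_slope u v y x b H ltac:(lra)).
  split; nra.
Qed.

Lemma continuous_weight (a : R -> R) (b : R) :
  (forall t, continuous a t) -> forall t, continuous (fun s => (b - s) * a s) t.
Proof.
  intros Ca t. apply (continuous_mult (fun s => b - s) a); [|apply Ca].
  apply (continuous_minus (fun _ => b) (fun s => s));
    [apply continuous_const | apply continuous_id].
Qed.

(** Taylor's formula with integral remainder: the right-hand side is the gap at [b] between the
    tangent at [a] and [u]. This is how the integrals in [Lambda1] and [Lambda2] arise. *)
Lemma concave_sol_taylor (u v y : R -> R) (a b : R) :
  concave_sol u v y ->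
  RInt (fun s => (b - s) * y s) a b = u a + (b - a) * v a - u b.
Proof.
  intros (Du & Dv & Cy & _).
  set (F := fun s => - ((b - s) * v s + u s)).
  assert (DF : forall s, is_derive F s ((b - s) * y s)).
  { intros s. unfold F.
    assert (Hd : is_derive (fun s => (b - s) * v s) s (- v s + (b - s) * - y s)).
    { replace (- v s + (b - s) * - y s) with ((0 - 1) * v s + (b - s) * - y s) by ring.
      apply (is_derive_mult (fun s => b - s) v s (0 - 1) (- y s)); [|apply Dv|].
      - apply (is_derive_minus (fun _ => b) (fun s => s) s 0 1).
        + apply (is_derive_const b s).
        + apply (is_derive_id s).
      - intros; apply Rmult_comm. }
    replace ((b - s) * y s) with (- ((- v s + (b - s) * - y s) + v s)) by ring.
    apply (is_derive_opp (fun s => (b - s) * v s + u s)).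
    apply (is_derive_plus (fun s => (b - s) * v s) u); [exact Hd | apply Du]. }
  apply is_RInt_unique.
  replace (u a + (b - a) * v a - u b) with (F b - F a) by (unfold F; ring).
  apply (is_RInt_derive F (fun s => (b - s) * y s)).
  - intros; apply DF.
  - intros s _. now apply continuous_weight.
Qed.

(* [J], the integral of the gap between [u] and its tangent at 0; the gap is
   convex, hence the trapezoid bound. *)
Lemma concave_sol_integral (u v y : R -> R) (b : R) :
  concave_sol u v y -> 0 <= b ->
  let J := u 0 * b + v 0 * b ^ 2 / 2 - RInt u 0 b in
  0 <= J /\ 2 * J <= b * (u 0 + v 0 * b - u b).
Proof.
  intros H Hb J.
  assert (Cu : forall t, continuous u t).
  { intros t. apply (ex_derive_continuous u). eexists; apply (proj1 H). }
  assert (DR : forall t, is_derive (RInt u 0) t (u t))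
    by (intros t; exact (is_derive_primitive_from_0 u t Cu)).
  assert (DI : forall t, is_derive (fun t => u 0 + v 0 * t - u t) t (v 0 - v t)).
  { intros t. apply (is_derive_minus (fun t => u 0 + v 0 * t) u); [|apply (proj1 H)].
    auto_derive; auto; ring. }
  assert (DJ : forall t, is_derive (fun t => u 0 * t + v 0 * t ^ 2 / 2 - RInt u 0 t) t
                          (u 0 + v 0 * t - u t)).
  { intros t. apply (is_derive_minus (fun t => u 0 * t + v 0 * t ^ 2 / 2) (RInt u 0));
      [|apply DR].
    auto_derive; auto; field. }
  assert (R0 : RInt u 0 0 = 0) by (rewrite RInt_point; reflexivity).
  split.
  - assert (M := is_derive_nondecreasing _ _ 0 b DJ Hb). cbv beta in M.
    rewrite R0 in M. unfold J.
    apply Rle_trans with (u 0 * 0 + v 0 * 0 ^ 2 / 2 - 0); [lra|]. apply M.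
    intros t Ht. destruct (concave_sol_tangent u v y 0 t H) as [H1 _]; lra.
  (* The function is [t * gap t - 2 * J t]. Its derivative [t * gap' t - gap t] is nonnegative
     because the gap is convex and vanishes at 0. *)
  - assert (DK : forall t, is_derive (fun t => t * (u 0 + v 0 * t - u t)
        - 2 * (u 0 * t + v 0 * t ^ 2 / 2 - RInt u 0 t)) t
        (t * (v 0 - v t) - (u 0 + v 0 * t - u t))).
    { intros t.
      replace (t * (v 0 - v t) - (u 0 + v 0 * t - u t))
        with ((1 * (u 0 + v 0 * t - u t) + t * (v 0 - v t))
              - (2 * (u 0 + v 0 * t - u t))) by ring.
      apply (is_derive_minus (fun t => t * (u 0 + v 0 * t - u t))
        (fun t => 2 * (u 0 * t + v 0 * t ^ 2 / 2 - RInt u 0 t))).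
      - apply (is_derive_mult (fun t => t) (fun t => u 0 + v 0 * t - u t));
          [apply (is_derive_id t) | apply DI | intros; apply Rmult_comm].
      - apply (is_derive_scal (fun t => u 0 * t + v 0 * t ^ 2 / 2 - RInt u 0 t) t 2).
        apply DJ. }
    assert (M := is_derive_nondecreasing _ _ 0 b DK Hb). cbv beta in M.
    rewrite R0 in M. unfold J.
    enough (0 * (u 0 + v 0 * 0 - u 0) - 2 * (u 0 * 0 + v 0 * 0 ^ 2 / 2 - 0) <=
      b * (u 0 + v 0 * b - u b) - 2 * (u 0 * b + v 0 * b ^ 2 / 2 - RInt u 0 b)) by lra.
    apply M. intros t Ht. destruct (concave_sol_tangent u v y 0 t H) as [_ H1]; lra.
Qed.

(** * A priori estimates from the boundary conditions *)

Lemma RInt_pos_part (u : R -> R) (b : R) :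
  0 <= b -> (forall t, 0 <= t <= b -> 0 <= u t) ->
  RInt (fun s => Rmax (u s) 0) 0 b = RInt u 0 b.
Proof.
  intros Hb Hu. apply RInt_ext. intros t Ht.
  rewrite Rmin_left, Rmax_right in Ht by lra. apply Rmax_left, Hu. lra.
Qed.

Lemma RInt_weight_le (c y : R -> R) (C a b : R) :
  a <= b -> (forall t, continuous c t) -> (forall t, continuous y t) ->
  (forall t, a <= t <= b -> y t <= C * c t) ->
  RInt (fun s => (b - s) * y s) a b <= C * RInt (fun s => (b - s) * c s) a b.
Proof.
  intros Hab Cc Cy Hle.
  assert (Hex : forall f : R -> R, (forall t, continuous f t) ->
    ex_RInt (fun s => (b - s) * f s) a b).
  { intros f Cf. apply (ex_RInt_continuous (V := R_CompleteNormedModule)).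
    intros; now apply continuous_weight. }
  rewrite <- (RInt_scal (V := R_CompleteNormedModule)) by now apply Hex.
  apply RInt_le; auto.
  - apply (ex_RInt_scal (V := R_CompleteNormedModule)). now apply Hex.
  - intros t Ht. change (scal C ((b - t) * c t)) with (C * ((b - t) * c t)).
    specialize (Hle t ltac:(lra)).
    assert (0 <= (b - t) * (C * c t - y t)) by (apply Rmult_le_pos; lra). lra.
Qed.

(** Twice the determinant of the linear system that the boundary conditions impose on the
    coefficients of [A + B * t]. It is the numerator of [Lambda1] and [Lambda2]. *)
Definition bvp_det (T eta alpha beta : R) : R :=
  (2 * T - alpha * eta ^ 2) - beta * (alpha * eta ^ 2 - 2 * eta + 2 * T).

(* [IT], [Ie] are the gaps at [T] and [eta] between a solution and its tangent
   at 0, and [J] is the integral of the gap over [0, eta]. *)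
Lemma tangent_line_bound (T eta alpha beta A B IT Ie J t : R) :
  0 < eta < T -> 0 < alpha -> 0 <= beta -> 0 < bvp_det T eta alpha beta ->
  0 <= Ie <= IT -> 0 <= J -> 0 <= t <= T ->
  A = beta * (A + B * eta - Ie) ->
  A + B * T - IT <= alpha * (A * eta + B * eta ^ 2 / 2 - J) ->
  bvp_det T eta alpha beta * (A + B * t)
  <= (2 * T + 2 * beta * eta + alpha * beta * eta ^ 2) * IT.
Proof.
  intros He Ha Hb HD HI HJ Ht HA HT.
  set (delta := A + B * T - IT - alpha * (A * eta + B * eta ^ 2 / 2 - J)).
  set (P := beta * eta + (1 - beta) * t).
  assert (Hdelta : delta <= 0) by (unfold delta; lra).
  (* [P] is affine in [t], equal to [beta * eta] at 0 and to half of
     [bvp_det + alpha * eta ^ 2 * (1 + beta)] at [T]. *)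
  assert (HP : 0 <= P).
  { assert (HPT : 0 <= T * P).
    { replace (T * P) with ((T - t) * (beta * eta) + t * ((bvp_det T eta alpha beta
        + alpha * eta ^ 2 * (1 + beta)) / 2)) by (unfold P, bvp_det; field).
      apply Rplus_le_le_0_compat; apply Rmult_le_pos; try lra.
      - apply Rmult_le_pos; lra.
      - assert (0 <= alpha * eta ^ 2 * (1 + beta)); [|lra].
        apply Rmult_le_pos; [|lra]. apply Rmult_le_pos; [lra|]. apply pow2_ge_0. }
    apply Rmult_le_reg_l with T; lra. }
  (* Cramer's rule for [A] and [B], with [delta] the defect of the condition at [T]. The last
     summand carries the condition at 0 and vanishes. *)
  assert (Hid : bvp_det T eta alpha beta * (A + B * t)
    = 2 * P * (IT - alpha * J + delta) - beta * Ie * (2 * T - alpha * eta ^ 2)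
      + 2 * beta * t * Ie * (1 - alpha * eta)
      + (A - beta * (A + B * eta - Ie)) * (2 * T - alpha * eta ^ 2 - 2 * t * (1 - alpha * eta))).
  { unfold bvp_det, P, delta. field. }
  rewrite Hid. replace (A - beta * (A + B * eta - Ie)) with 0 by lra.
  assert (K1 : 0 <= (T - t) * IT) by (apply Rmult_le_pos; lra).
  assert (K2 : 0 <= alpha * beta * eta ^ 2 * (IT - Ie)).
  { apply Rmult_le_pos; [|lra]. apply Rmult_le_pos; [|apply pow2_ge_0].
    apply Rmult_le_pos; lra. }
  assert (K3 : 0 <= beta * t * (IT - Ie))
    by (apply Rmult_le_pos; [apply Rmult_le_pos|]; lra).
  assert (K4 : 0 <= beta * T * Ie) by (apply Rmult_le_pos; [apply Rmult_le_pos|]; lra).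
  assert (K5 : 0 <= P * (alpha * J))
    by (apply Rmult_le_pos; [|apply Rmult_le_pos]; lra).
  assert (K6 : 0 <= beta * t * (alpha * eta) * Ie)
    by (repeat apply Rmult_le_pos; lra).
  assert (K7 : 0 <= P * (- delta)) by (apply Rmult_le_pos; lra).
  unfold P in *. nra.
Qed.

(** Here [De] is the drop of the slope over [[0, eta]], so the left-hand side is [2 * eta] times the
    gap at [T] between the tangent at [eta] and the solution. The bounds on [Ie] and [J] express
    convexity of the gap to the tangent at 0. *)
Lemma value_at_eta_bound (T eta alpha beta A B IT Ie De J : R) :
  0 < eta < T -> 0 < alpha -> Ie <= eta * De -> 2 * J <= eta * Ie ->
  A = beta * (A + B * eta - Ie) ->
  alpha * (A * eta + B * eta ^ 2 / 2 - J) <= A + B * T - IT ->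
  2 * eta * (IT - (T - eta) * De - Ie)
  <= bvp_det T eta alpha beta * (A + B * eta - Ie).
Proof.
  intros He Ha HD HJ HA HT.
  set (delta := A + B * T - IT - alpha * (A * eta + B * eta ^ 2 / 2 - J)).
  assert (Hdelta : 0 <= delta) by (unfold delta; lra).
  assert (Hid : bvp_det T eta alpha beta * (A + B * eta - Ie)
    = 2 * eta * (IT - alpha * J + delta) - (2 * T - alpha * eta ^ 2) * Ie
      + (A - beta * (A + B * eta - Ie)) * (2 * T - 2 * eta + alpha * eta ^ 2)).
  { unfold bvp_det, delta. field. }
  rewrite Hid. replace (A - beta * (A + B * eta - Ie)) with 0 by lra.
  assert (K1 : 0 <= (T - eta) * (eta * De - Ie)) by (apply Rmult_le_pos; lra).
  assert (K2 : 0 <= alpha * eta * (eta * Ie - 2 * J))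
    by (repeat apply Rmult_le_pos; lra).
  assert (K3 : 0 <= eta * delta) by (apply Rmult_le_pos; lra).
  nra.
Qed.

(** Let [N] be the maximum over [[0, T]] of the tangent at 0. As [u] lies below the tangent,
    [y <= kappa * N * a], so the gap at [T] is at most [kappa * N * W]. If the conclusion failed,
    [tangent_line_bound] at the maximum would give [bvp_det * N <= E * kappa * N * W], against the
    choice of [kappa]. *)
Lemma small_solution (T eta alpha beta kappa sigma rho : R) (a F u v y : R -> R) :
  0 < eta < T -> 0 < alpha -> 0 <= beta -> 0 < bvp_det T eta alpha beta -> 0 < rho ->
  0 <= kappa ->
  kappa * ((2 * (beta + 1) * T + beta * eta * (alpha * eta + 2) + alpha * beta * T ^ 2)
     * RInt (fun s => (T - s) * a s) 0 T) < bvp_det T eta alpha beta ->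
  (forall t, continuous a t) -> (forall t, 0 <= a t) ->
  (forall x, x <= sigma -> F x <= kappa * Rmax x 0) ->
  concave_sol u v y -> (forall t, 0 <= t <= T -> y t = a t * F (u t)) ->
  u 0 = beta * Rmax (u eta) 0 -> u 0 + v 0 * eta = rho ->
  u 0 <= sigma -> u 0 + v 0 * T <= sigma ->
  alpha * RInt (fun s => Rmax (u s) 0) 0 eta < u T.
Proof.
  intros He Ha Hb HD Hrho Hk HW Ca Ha0 HF H Hy Hu0 Hline Hs0 HsT.
  set (W := RInt (fun s => (T - s) * a s) 0 T) in *.
  set (E := 2 * (beta + 1) * T + beta * eta * (alpha * eta + 2) + alpha * beta * T ^ 2) in *.
  (* [E] is the bracket of [Lambda1] multiplied by [T]; it dominates the constant of
     [tangent_line_bound]. *)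
  assert (HE : 2 * T + 2 * beta * eta + alpha * beta * eta ^ 2 <= E).
  { unfold E. assert (0 <= beta * T) by (apply Rmult_le_pos; lra).
    assert (0 <= alpha * beta * T ^ 2); [|nra].
    apply Rmult_le_pos; [apply Rmult_le_pos; lra | apply pow2_ge_0]. }
  assert (Hbe : 0 <= beta * eta) by (apply Rmult_le_pos; lra).
  assert (Habe : 0 <= alpha * beta * eta ^ 2).
  { apply Rmult_le_pos; [apply Rmult_le_pos; lra | apply pow2_ge_0]. }
  assert (H00 : 0 <= u 0).
  { rewrite Hu0. apply Rmult_le_pos; [lra | apply Rmax_r]. }
  set (N := Rmax (u 0) (u 0 + v 0 * T)).
  assert (Hlin : forall t, 0 <= t <= T -> u 0 + v 0 * t <= N).
  { intros t Ht. unfold N.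
    assert (N1 := Rmax_l (u 0) (u 0 + v 0 * T)). assert (N2 := Rmax_r (u 0) (u 0 + v 0 * T)).
    destruct (Rle_dec 0 (v 0)).
    - apply Rle_trans with (u 0 + v 0 * T); [|exact N2].
      apply Rplus_le_compat_l, Rmult_le_compat_l; lra.
    - apply Rle_trans with (u 0); [|exact N1]. nra. }
  assert (HN : 0 < N) by (specialize (Hlin eta ltac:(lra)); lra).
  assert (HNs : N <= sigma) by (apply Rmax_lub; assumption).
  assert (HyN : forall t, 0 <= t <= T -> y t <= kappa * N * a t).
  { intros t Ht. rewrite Hy by exact Ht.
    destruct (concave_sol_tangent u v y 0 t H) as [Hut _]; [lra|].
    specialize (Hlin t Ht). rewrite Rminus_0_r in Hut.
    rewrite Rmult_comm. apply Rmult_le_compat_r; [apply Ha0|].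
    apply Rle_trans with (1 := HF (u t) ltac:(lra)).
    apply Rmult_le_compat_l; [lra|]. apply Rmax_lub; lra. }
  assert (HIT : u 0 + v 0 * T - u T <= kappa * N * W).
  { assert (Hw := RInt_weight_le a y (kappa * N) 0 T ltac:(lra) Ca (proj1 (proj2 (proj2 H))) HyN).
    rewrite (concave_sol_taylor u v y 0 T H) in Hw. unfold W. lra. }
  assert (HkE : kappa * W * E * N < bvp_det T eta alpha beta * N).
  { apply Rmult_lt_compat_r; [exact HN|]. lra. }
  destruct (concave_sol_tangent u v y 0 eta H) as [He1 _]; [lra|].
  destruct (concave_sol_tangent u v y eta T H) as [HT1 _]; [lra|].
  assert (Hse := concave_sol_slope u v y 0 eta H ltac:(lra)).
  assert (HgT : u 0 + v 0 * eta - u eta <= u 0 + v 0 * T - u T).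
  { assert (v eta * (T - eta) <= v 0 * (T - eta)) by (apply Rmult_le_compat_r; lra). lra. }
  destruct (Rle_dec 0 (u eta)) as [Hue | Hue].
  - rewrite Rmax_left in Hu0 by exact Hue.
    rewrite RInt_pos_part; [|lra|].
    2: { intros t Ht. assert (C := concave_sol_chord u v y 0 t eta H ltac:(lra) ltac:(lra)).
      assert (0 <= (eta - t) * u 0 + (t - 0) * u eta)
        by (apply Rplus_le_le_0_compat; apply Rmult_le_pos; lra).
      apply Rmult_le_reg_l with (eta - 0); lra. }
    apply Rnot_le_lt. intros Hneg.
    destruct (concave_sol_integral u v y eta H) as [J1 _]; [lra|].
    set (J := u 0 * eta + v 0 * eta ^ 2 / 2 - RInt u 0 eta) in *.
    assert (B : forall t, 0 <= t <= T -> bvp_det T eta alpha beta * (u 0 + v 0 * t)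
       <= (2 * T + 2 * beta * eta + alpha * beta * eta ^ 2) * (u 0 + v 0 * T - u T)).
    { intros t Ht.
      apply (tangent_line_bound T eta alpha beta (u 0) (v 0) _ (u 0 + v 0 * eta - u eta) J);
        auto; try lra.
      unfold J. lra. }
    assert (BN : bvp_det T eta alpha beta * N
       <= (2 * T + 2 * beta * eta + alpha * beta * eta ^ 2) * (u 0 + v 0 * T - u T)).
    { unfold N, Rmax. destruct Rle_dec.
      - apply B. lra.
      - specialize (B 0 ltac:(lra)). now rewrite Rmult_0_r, Rplus_0_r in B. }
    assert (BE : (2 * T + 2 * beta * eta + alpha * beta * eta ^ 2) * (u 0 + v 0 * T - u T)
       <= E * (kappa * N * W)).
    { apply Rmult_le_compat; try lra. }
    lra.
  (* If [u eta < 0], then [u 0 = 0] and the chord makes [u T] negative, so the gap at [T] exceeds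
     [N] and [kappa * W > 1]. This is impossible since [bvp_det <= 2 * T <= E]. *)
  - exfalso. apply Rnot_le_lt in Hue. rewrite Rmax_right in Hu0 by lra.
    rewrite Rmult_0_r in Hu0.
    assert (C := concave_sol_chord u v y 0 eta T H ltac:(lra) ltac:(lra)).
    assert (HuT : u T < 0) by (rewrite Hu0 in C; nra).
    assert (Hv0 : 0 < v 0) by (rewrite Hu0 in Hline; nra).
    assert (HNT : N = v 0 * T).
    { unfold N. rewrite Hu0, Rplus_0_l. apply Rmax_right. apply Rmult_le_pos; lra. }
    assert (HkW : 1 < kappa * W).
    { apply Rmult_lt_reg_r with N; [exact HN|]. lra. }
    assert (HDT : bvp_det T eta alpha beta <= 2 * T).
    { unfold bvp_det. assert (0 <= alpha * eta ^ 2)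
        by (apply Rmult_le_pos; [lra | apply pow2_ge_0]).
      assert (0 <= beta * (alpha * eta ^ 2 - 2 * eta + 2 * T))
        by (apply Rmult_le_pos; lra). lra. }
    assert (E <= kappa * W * E) by nra. lra.
Qed.

(** Otherwise [u] is nonnegative on [[0, T]], and the boundary conditions with concavity give
    [u >= gam * u eta] on [[eta, T]]. Then [y >= kappa * gam * u eta * a] there, so the gap at [T]
    to the tangent at [eta] is at least [kappa * gam * u eta * V], too much for
    [value_at_eta_bound]. *)
Lemma large_solution (T eta alpha beta kappa gam m0 Fm am M rho : R)
  (a F u v y : R -> R) :
  0 < eta < T -> 0 < alpha -> 0 <= beta -> 0 < bvp_det T eta alpha beta ->
  0 <= kappa -> 0 < gam <= 1 -> gam <= alpha * eta * (1 + beta) / 2 ->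
  bvp_det T eta alpha beta
    < 2 * eta * gam * kappa * RInt (fun s => (T - s) * a s) eta T ->
  (forall t, continuous a t) -> (forall t, 0 <= a t <= am) ->
  0 < m0 -> 0 <= Fm ->
  (forall x, m0 <= x <= M -> kappa * x <= F x) ->
  (forall x, 0 <= F x) ->
  (forall x, 0 <= x <= m0 / gam * T / (T - eta) -> F x <= Fm) ->
  concave_sol u v y -> (forall t, 0 <= t <= T -> y t = a t * F (u t)) ->
  u 0 = beta * Rmax (u eta) 0 -> u 0 + v 0 * eta = rho ->
  u 0 <= M -> u 0 + v 0 * T <= M ->
  m0 / gam + eta ^ 2 * (am * Fm) < rho ->
  u T < alpha * RInt (fun s => Rmax (u s) 0) 0 eta.
Proof.
  intros He Ha Hb HD Hk Hg Hg2 HV Ca Ha0 Hm0 HFm HFk HF0 HFb H Hy Hu0 Hline HsM HsT Hrho.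
  apply Rnot_le_lt. intros Hneg.
  set (V := RInt (fun s => (T - s) * a s) eta T) in *.
  assert (H00 : 0 <= u 0).
  { rewrite Hu0. apply Rmult_le_pos; [lra | apply Rmax_r]. }
  assert (HuT : 0 <= u T).
  { apply Rle_trans with (2 := Hneg). apply Rmult_le_pos; [lra|].
    apply RInt_ge_0; [lra| |intros; apply Rmax_r].
    apply (ex_RInt_continuous (V := R_CompleteNormedModule)). intros s _.
    apply (continuous_comp u (fun z => Rmax z 0)); [|apply continuous_Rmax0].
    apply (ex_derive_continuous u). eexists; apply (proj1 H). }
  assert (Hpos : forall t, 0 <= t <= T -> 0 <= u t).
  { intros t Ht. assert (C := concave_sol_chord u v y 0 t T H ltac:(lra) ltac:(lra)).
    assert (0 <= (T - t) * u 0 + (t - 0) * u T)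
      by (apply Rplus_le_le_0_compat; apply Rmult_le_pos; lra).
    apply Rmult_le_reg_l with (T - 0); lra. }
  assert (Hue := Hpos eta ltac:(lra)).
  rewrite Rmax_left in Hu0 by exact Hue.
  rewrite RInt_pos_part in Hneg by (try lra; intros; apply Hpos; lra).
  destruct (concave_sol_integral u v y eta H) as [_ J2]; [lra|].
  set (J := u 0 * eta + v 0 * eta ^ 2 / 2 - RInt u 0 eta) in *.
  destruct (concave_sol_tangent u v y 0 eta H) as [_ Hte]; [lra|].
  (* If [u eta] were smaller, the chord from [t] to [T] would bound [u] on [[0, eta]] by
     [m0 / gam * T / (T - eta)], hence [y] by [am * Fm]. Then [u eta] would fall below the tangent
     value [rho] by at most [eta ^ 2 * (am * Fm)]. *)
  assert (Hbig : m0 / gam <= u eta).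
  { apply Rnot_lt_le. intros Hsmall.
    assert (Hle : forall t, 0 <= t <= eta -> y t <= am * Fm).
    { intros t Ht. rewrite Hy by lra. assert (Hat := Ha0 t).
      apply Rmult_le_compat; try lra; [apply HF0|].
      apply HFb. split; [apply Hpos; lra|].
      assert (C := concave_sol_chord u v y t eta T H ltac:(lra) ltac:(lra)).
      apply Rle_div_r; [lra|].
      assert (0 <= (eta - t) * u T) by (apply Rmult_le_pos; lra).
      assert ((T - t) * u eta <= T * (m0 / gam)) by (apply Rmult_le_compat; lra). lra. }
    destruct (is_derive_increment v (fun t => - y t) 0 eta (proj1 (proj2 H)) ltac:(lra))
      as [x [Hx Ex]].
    specialize (Hle x Hx).
    assert (Hd : v 0 - v eta <= eta * (am * Fm)).
    { replace (v 0 - v eta) with (eta * y x) by lra. apply Rmult_le_compat_l; lra. }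
    assert (eta * (v 0 - v eta) <= eta * (eta * (am * Fm)))
      by (apply Rmult_le_compat_l; lra).
    replace (eta ^ 2 * (am * Fm)) with (eta * (eta * (am * Fm))) in Hrho by ring.
    lra. }
  assert (Hc : 0 < u eta).
  { apply Rlt_le_trans with (2 := Hbig). apply Rdiv_lt_0_compat; lra. }
  (* By the trapezoid bound, the integral over [[0, eta]] is at least [eta * (u 0 + u eta) / 2], and
     [u 0 = beta * u eta]. *)
  assert (HuTg : gam * u eta <= u T).
  { apply Rle_trans with (2 := Hneg).
    apply Rle_trans with (alpha * (eta * (1 + beta) * u eta / 2)).
    - replace (alpha * (eta * (1 + beta) * u eta / 2))
        with (alpha * eta * (1 + beta) / 2 * u eta) by field.
      apply Rmult_le_compat_r; lra.
    - apply Rmult_le_compat_l; [lra|].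
      replace (eta * (1 + beta) * u eta / 2) with (eta * (u 0 + u eta) / 2)
        by (rewrite Hu0; field).
      unfold J in J2. lra. }
  assert (Hlow : forall t, eta <= t <= T -> gam * u eta <= u t).
  { intros t Ht. assert (C := concave_sol_chord u v y eta t T H ltac:(lra) ltac:(lra)).
    assert (G : gam * u eta <= u eta) by nra.
    assert ((T - t) * (gam * u eta) <= (T - t) * u eta) by (apply Rmult_le_compat_l; lra).
    assert ((t - eta) * (gam * u eta) <= (t - eta) * u T) by (apply Rmult_le_compat_l; lra).
    apply Rmult_le_reg_l with (T - eta); lra. }
  assert (Hg0 : m0 <= gam * u eta).
  { apply (Rmult_le_compat_l gam) in Hbig; [|lra].
    replace (gam * (m0 / gam)) with m0 in Hbig by (field; lra). exact Hbig. }
  assert (HyV : forall t, eta <= t <= T -> kappa * (gam * u eta) * a t <= y t).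
  { intros t Ht. rewrite Hy by lra. specialize (Hlow t Ht).
    destruct (concave_sol_tangent u v y 0 t H) as [Hut _]; [lra|].
    assert (HtM : u t <= M).
    { apply Rle_trans with (1 := Hut). rewrite Rminus_0_r.
      destruct (Rle_dec 0 (v 0)).
      - apply Rle_trans with (2 := HsT). apply Rplus_le_compat_l, Rmult_le_compat_l; lra.
      - nra. }
    rewrite Rmult_comm. apply Rmult_le_compat_l; [apply Ha0|].
    apply Rle_trans with (kappa * u t).
    - apply Rmult_le_compat_l; lra.
    - apply HFk. lra. }
  assert (HVy : kappa * (gam * u eta) * V <= u eta + (T - eta) * v eta - u T).
  { rewrite <- (concave_sol_taylor u v y eta T H).
    assert (C1 : forall t, continuous (fun t => kappa * (gam * u eta) * a t) t).
    { intros t. apply (continuous_mult (fun _ => kappa * (gam * u eta)) a);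
        [apply continuous_const | apply Ca]. }
    assert (Hw := RInt_weight_le y (fun t => kappa * (gam * u eta) * a t) 1 eta T
      ltac:(lra) (proj1 (proj2 (proj2 H))) C1
      (fun t Ht => Rle_trans _ _ _ (HyV t Ht) (Req_le _ _ (eq_sym (Rmult_1_l _))))).
    rewrite Rmult_1_l in Hw. apply Rle_trans with (2 := Hw). right. unfold V.
    rewrite <- (RInt_scal (V := R_CompleteNormedModule)).
    - apply RInt_ext. intros t _.
      change (kappa * (gam * u eta) * ((T - t) * a t)
              = (T - t) * (kappa * (gam * u eta) * a t) :> R). ring.
    - apply (ex_RInt_continuous (V := R_CompleteNormedModule)).
      intros; now apply continuous_weight. }
  assert (B := value_at_eta_bound T eta alpha beta (u 0) (v 0)
    (u 0 + v 0 * T - u T) (u 0 + v 0 * eta - u eta) (v 0 - v eta) J He Ha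
    ltac:(lra) ltac:(lra)).
  replace (u 0 + v 0 * eta - (u 0 + v 0 * eta - u eta)) with (u eta) in B by ring.
  replace (u 0 + v 0 * T - (u 0 + v 0 * T - u T)) with (u T) in B by ring.
  assert (EJ : u 0 * eta + v 0 * eta ^ 2 / 2 - J = RInt u 0 eta :> R) by (unfold J; lra).
  rewrite EJ in B.
  specialize (B Hu0 Hneg).
  replace (u 0 + v 0 * T - u T - (T - eta) * (v 0 - v eta) - (u 0 + v 0 * eta - u eta))
    with (u eta + (T - eta) * v eta - u T) in B by ring.
  apply (Rmult_le_compat_l (2 * eta)) in HVy; [|lra].
  apply (Rmult_lt_compat_r (u eta)) in HV; [|exact Hc].
  lra.
Qed.

(** * Shooting *)

(* Parameters: [r] is the value at [eta] of the tangent at 0, and [s r] is the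
   prescribed value of [Rmax (u eta) 0]; then [u 0 = beta s r]. *)
Lemma euler_planar_zero (g : R -> R -> R) (h eta alpha beta r0 r1 : R) (ke kT : nat) :
  0 < h -> 0 < eta -> INR ke * h = eta -> 0 < alpha -> 0 <= beta ->
  0 < r0 < r1 ->
  (forall t x, 0 <= g t x) ->
  (forall e, 0 < e -> exists d, 0 < d /\
     forall t x x', Rabs (x - x') < d -> Rabs (g t x - g t x') < e) ->
  forall e, 0 < e ->
  exists s r,
    let A := beta * (s * r) in let B := (r - A) / eta in
    let G2 := euler_u g h A B kT - alpha * euler_s g h A B ke in
    0 <= s <= 1 /\ r0 <= r <= r1 /\
    Rabs (s * r - Rmax (euler_u g h A B ke) 0) <= e /\
    (- e <= G2 \/ r <= r0 + e) /\ (G2 <= e \/ r1 - e <= r).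
Proof.
  intros Hh He Hke Ha Hb Hr Hg Huc e Hee.
  set (A := fun s r => beta * (s * r)). set (B := fun s r => (r - A s r) / eta).
  apply (approximate_planar_zero
    (fun s r => s * r - Rmax (euler_u g h (A s r) (B s r) ke) 0)
    (fun s r => euler_u g h (A s r) (B s r) kT - alpha * euler_s g h (A s r) (B s r) ke));
    [lra | | | | exact Hee].
  - intros e' He'.
    set (e1 := e' / (2 * (1 + alpha))).
    assert (He1 : 0 < e1) by (apply Rdiv_lt_0_compat; lra).
    assert (Ee1 : e1 + alpha * e1 = e' / 2) by (unfold e1; field; lra).
    assert (Hae1 : 0 < alpha * e1) by (apply Rmult_lt_0_compat; lra).
    destruct (euler_unif_cont g h ke Hh Huc e1 He1) as [d1 [Hd1 H1]].
    destruct (euler_unif_cont g h kT Hh Huc e1 He1) as [d2 [Hd2 H2]].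
    set (d := Rmin e1 (Rmin d1 d2)).
    assert (Hd : 0 < d) by (unfold d; repeat apply Rmin_glb_lt; lra).
    assert (De : d <= e1) by apply Rmin_l.
    assert (Dd1 : d <= d1) by (apply Rle_trans with (1 := Rmin_r _ _); apply Rmin_l).
    assert (Dd2 : d <= d2) by (apply Rle_trans with (1 := Rmin_r _ _); apply Rmin_r).
    (* A common Lipschitz constant for [s * r], [A] and [B] as functions of the two parameters. *)
    set (K := (1 + r1) * (1 + beta) * (1 + / eta)).
    assert (Hie : 0 < / eta) by now apply Rinv_0_lt_compat.
    assert (HK1 : 1 + r1 <= K).
    { unfold K. rewrite Rmult_assoc. rewrite <- (Rmult_1_r (1 + r1)) at 1.
      apply Rmult_le_compat_l; [lra|]. nra. }
    exists (d / K). assert (HdK : 0 < d / K) by (apply Rdiv_lt_0_compat; lra).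
    split; [exact HdK|]. intros s s' r r' Hs Hs' Hrr Hrr' Ds Dr.
    assert (Dsr : Rabs (s * r - s' * r') < (1 + r1) * (d / K)).
    { replace (s * r - s' * r') with ((s - s') * r + s' * (r - r')) by ring.
      eapply Rle_lt_trans; [apply Rabs_triang|].
      rewrite !Rabs_mult, (Rabs_pos_eq r), (Rabs_pos_eq s') by lra.
      assert (Rabs (s - s') * r <= d / K * r1)
        by (apply Rmult_le_compat; try lra; apply Rabs_pos).
      assert (s' * Rabs (r - r') <= 1 * Rabs (r - r'))
        by (apply Rmult_le_compat_r; [apply Rabs_pos | lra]).
      lra. }
    set (q := (1 + r1) * (d / K)) in *.
    assert (Hq0 : 0 < q) by (apply Rmult_lt_0_compat; lra).
    assert (HqK : q * ((1 + beta) * (1 + / eta)) = d).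
    { unfold q, K. field. repeat split; lra. }
    assert (Hbe : 0 <= beta * / eta) by (apply Rmult_le_pos; lra).
    assert (Hqd : q + q * beta + q * / eta + q * (beta * / eta) = d) by (rewrite <- HqK; ring).
    assert (Q1 : 0 <= q * beta) by (apply Rmult_le_pos; lra).
    assert (Q2 : 0 <= q * / eta) by (apply Rmult_le_pos; lra).
    assert (Q3 : 0 <= q * (beta * / eta)) by (apply Rmult_le_pos; lra).
    assert (Hrq : Rabs (r - r') <= q).
    { unfold q. apply Rlt_le, Rlt_le_trans with (1 := Dr).
      rewrite <- (Rmult_1_l (d / K)) at 1. apply Rmult_le_compat_r; lra. }
    assert (DA0 : Rabs (A s r - A s' r') <= q * beta).
    { unfold A. replace (_ - _) with (beta * (s * r - s' * r')) by ring.
      rewrite Rabs_mult, (Rabs_pos_eq beta), Rmult_comm by lra.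
      apply Rmult_le_compat_r; lra. }
    assert (DA : Rabs (A s r - A s' r') < d) by lra.
    assert (DB : Rabs (B s r - B s' r') < d).
    { unfold B. replace (_ - _) with (((r - r') - (A s r - A s' r')) * / eta)
        by (field; lra).
      rewrite Rabs_mult, (Rabs_pos_eq (/ eta)) by lra.
      assert (Ht : Rabs ((r - r') - (A s r - A s' r')) <= q + q * beta).
      { eapply Rle_trans; [apply Rabs_triang|]. rewrite Rabs_Ropp. lra. }
      apply (Rmult_le_compat_r (/ eta)) in Ht; lra. }
    destruct (H1 (A s r) (A s' r') (B s r) (B s' r')) as (U1 & _ & S1); try lra.
    destruct (H2 (A s r) (A s' r') (B s r) (B s' r')) as (U2 & _ & _); try lra.
    assert (M1 := Rmax0_lipschitz (euler_u g h (A s r) (B s r) ke)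
      (euler_u g h (A s' r') (B s' r') ke)).
    split.
    + replace (_ - _) with ((s * r - s' * r')
        - (Rmax (euler_u g h (A s r) (B s r) ke) 0
           - Rmax (euler_u g h (A s' r') (B s' r') ke) 0)) by ring.
      eapply Rle_lt_trans; [apply Rabs_triang|]. rewrite Rabs_Ropp.
      assert (e1 <= e' / 2) by lra. lra.
    + replace (_ - _) with ((euler_u g h (A s r) (B s r) kT - euler_u g h (A s' r') (B s' r') kT)
        + alpha * - (euler_s g h (A s r) (B s r) ke - euler_s g h (A s' r') (B s' r') ke)) by ring.
      eapply Rle_lt_trans; [apply Rabs_triang|].
      rewrite Rabs_mult, Rabs_Ropp, (Rabs_pos_eq alpha) by lra.
      apply (Rmult_lt_compat_l alpha) in S1; lra.
  - intros r Hrr. rewrite Rmult_0_l.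
    assert (M := Rmax_r (euler_u g h (A 0 r) (B 0 r) ke) 0). lra.
  (* As [eta] is exactly the node [ke], the discrete tangent takes the value [r] there, with no
     discretization error. *)
  - intros r Hrr. rewrite Rmult_1_l.
    enough (Rmax (euler_u g h (A 1 r) (B 1 r) ke) 0 <= r) by lra.
    apply Rmax_lub; [|lra].
    destruct (euler_le_tangent g h (A 1 r) (B 1 r) ke Hh Hg) as [_ E].
    rewrite Hke in E. replace (A 1 r + B 1 r * eta) with r in E
      by (unfold B; field; lra).
    exact E.
Qed.

(** The outcome is an exact zero of [G1], and of [G2] unless [r] is an end of its range. The caller
    excludes the ends by estimates for exact solutions. *)
Lemma shooting_solution (g : R -> R -> R) (T eta alpha beta r0 r1 Y : R) :
  0 < eta < T -> 0 < alpha -> 0 <= beta -> 0 < r0 < r1 ->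
  (forall t x, 0 <= g t x <= Y) ->
  (forall e, 0 < e -> exists d, 0 < d /\ forall t t' x x',
     Rabs (t - t') < d -> Rabs (x - x') < d -> Rabs (g t x - g t' x') < e) ->
  exists (u v y : R -> R) (s r : R),
    let G2 := u T - alpha * RInt (fun s => Rmax (u s) 0) 0 eta in
    concave_sol u v y /\ (forall t, 0 <= t <= T -> y t = g t (u t)) /\
    0 <= s <= 1 /\ r0 <= r <= r1 /\
    Rmax (u eta) 0 = s * r /\
    u 0 = beta * Rmax (u eta) 0 /\ u 0 + v 0 * eta = r /\
    (0 <= G2 \/ r = r0) /\ (G2 <= 0 \/ r = r1).
Proof.
  intros He Ha Hb Hr Hg Huc.
  destruct nat_ultrafilter as (U & HU & Hult & Hev).
  assert (HF : Filter U) by apply HU.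
  set (e := fun n => / (INR n + 1)). set (h := fun n => eta * e n).
  assert (HS : forall n, 0 < INR n + 1) by (intros n; assert (Hn := pos_INR n); lra).
  assert (Hep : forall n, 0 < e n) by (intros n; apply Rinv_0_lt_compat, HS).
  assert (Hh : forall n, 0 < h n) by (intros n; apply Rmult_lt_0_compat; [lra | apply Hep]).
  assert (Le : filterlim e U (locally 0)).
  { apply filterlim_R_eps; auto. intros eps Heps.
    destruct (archimed_cor1 eps Heps) as [N [HN HN0]].
    generalize (Hev N). apply filter_imp. intros n Hn. rewrite Rminus_0_r, Rabs_pos_eq
      by (left; apply Hep).
    apply Rle_lt_trans with (2 := HN). unfold e. apply Rinv_le_contravar.
    - apply lt_0_INR. lia.
    - apply le_INR in Hn. lra. }
  assert (Lh : filterlim h U (locally 0)).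
  { replace 0 with (eta * 0) by ring. now apply filterlim_R_scal. }
  assert (Hke : forall n, INR (S n) * h n = eta).
  { intros n. rewrite S_INR. unfold h, e. specialize (HS n). field. lra. }
  assert (Hkf : forall n, nat_floor (eta / h n) = S n).
  { intros n. replace (eta / h n) with (INR (S n)); [apply nat_floor_INR|].
    specialize (Hh n). apply Rmult_eq_reg_r with (h n); [|lra].
    rewrite Hke. field. lra. }
  assert (Hucx : forall e, 0 < e -> exists d, 0 < d /\
     forall t x x', Rabs (x - x') < d -> Rabs (g t x - g t x') < e).
  { intros e' He'. destruct (Huc e' He') as [d [Hd H]]. exists d. split; [exact Hd|].
    intros t x x' Hx. apply H; auto. now rewrite Rminus_diag, Rabs_R0. }
  destruct (functional_choice (fun n (p : R * R) =>
    let s := fst p in let r := snd p in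
    let A := beta * (s * r) in let B := (r - A) / eta in
    let G2 := euler_u g (h n) A B (nat_floor (T / h n))
              - alpha * euler_s g (h n) A B (nat_floor (eta / h n)) in
    0 <= s <= 1 /\ r0 <= r <= r1 /\
    Rabs (s * r - Rmax (euler_u g (h n) A B (nat_floor (eta / h n))) 0) <= e n /\
    (- e n <= G2 \/ r <= r0 + e n) /\ (G2 <= e n \/ r1 - e n <= r))) as [p Hp].
  (* [T] need not be a node; the node just before it is used and has the same limit. *)
  { intros n. rewrite Hkf.
    destruct (euler_planar_zero g (h n) eta alpha beta r0 r1 (S n)
      (nat_floor (T / h n))) with (e := e n) as [s [r Hsr]]; auto; try lra.
    - intros; apply Hg.
    - now exists (s, r). }
  set (sn := fun n => fst (p n)). set (rn := fun n => snd (p n)).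
  set (An := fun n => beta * (sn n * rn n)). set (Bn := fun n => (rn n - An n) / eta).
  assert (Hp' : forall n,
    let G2 := euler_u g (h n) (An n) (Bn n) (nat_floor (T / h n))
              - alpha * euler_s g (h n) (An n) (Bn n) (nat_floor (eta / h n)) in
    0 <= sn n <= 1 /\ r0 <= rn n <= r1 /\
    Rabs (sn n * rn n - Rmax (euler_u g (h n) (An n) (Bn n) (nat_floor (eta / h n))) 0) <= e n /\
    (- e n <= G2 \/ rn n <= r0 + e n) /\ (G2 <= e n \/ r1 - e n <= rn n)) by exact Hp.
  clear Hp. clearbody sn rn.
  destruct (bounded_ultralimit U sn 1 HU Hult) as [s Ls].
  { apply filter_forall. intros n. apply Rabs_le_between.
    assert (H := proj1 (Hp' n)). lra. }
  destruct (bounded_ultralimit U rn r1 HU Hult) as [r Lr].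
  { apply filter_forall. intros n. apply Rabs_le_between.
    assert (H := proj1 (proj2 (Hp' n))). lra. }
  assert (Lsr : filterlim (fun n => sn n * rn n) U (locally (s * r)))
    by now apply filterlim_R_mult.
  assert (LA : filterlim An U (locally (beta * (s * r)))) by now apply filterlim_R_scal.
  assert (LB : filterlim Bn U (locally ((r - beta * (s * r)) / eta))).
  { replace ((r - beta * (s * r)) / eta) with (/ eta * (r - beta * (s * r)))
      by (unfold Rdiv; ring).
    apply (filterlim_ext (fun n => / eta * (rn n - An n))).
    - intros n. unfold Bn, Rdiv. ring.
    - apply filterlim_R_scal; auto. now apply filterlim_R_minus. }
  assert (Lc : forall c : R, filterlim (fun _ : nat => c) U (locally c))
    by (intros; apply filterlim_const).
  assert (Bs : 0 <= s <= 1).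
  { split.
    - apply (filterlim_R_le U (fun _ => 0) sn _ _ HU (Lc 0) Ls).
      apply filter_forall. intros n. apply (Hp' n).
    - apply (filterlim_R_le U sn (fun _ => 1) _ _ HU Ls (Lc 1)).
      apply filter_forall. intros n. apply (Hp' n). }
  assert (Br : r0 <= r <= r1).
  { split.
    - apply (filterlim_R_le U (fun _ => r0) rn _ _ HU (Lc r0) Lr).
      apply filter_forall. intros n. apply (Hp' n).
    - apply (filterlim_R_le U rn (fun _ => r1) _ _ HU Lr (Lc r1)).
      apply filter_forall. intros n. apply (Hp' n). }
  assert (HAn : forall n, 0 <= An n <= beta * r1).
  { intros n. destruct (Hp' n) as (H1 & H2 & _). unfold An. split.
    - repeat apply Rmult_le_pos; lra.
    - apply Rmult_le_compat_l; [lra|].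
      rewrite <- (Rmult_1_l r1). apply Rmult_le_compat; lra. }
  destruct (euler_limit U g h An Bn T Y (beta * r1) ((r1 + beta * r1) / eta)
    (beta * (s * r)) ((r - beta * (s * r)) / eta))
    as (u & v & y & Du & Dv & Cy & Py & Ey & U0 & V0 & Lu & LS); auto; try lra.
  { intros n. rewrite Rabs_pos_eq; apply HAn. }
  { intros n. unfold Bn, Rdiv. rewrite Rabs_mult, (Rabs_pos_eq (/ eta))
      by (left; apply Rinv_0_lt_compat; lra).
    apply Rmult_le_compat_r; [left; apply Rinv_0_lt_compat; lra|].
    destruct (Hp' n) as (_ & H2 & _). specialize (HAn n). apply Rabs_le_between. lra. }
  assert (Lue := filterlim_R_pos_part U _ _ HF (Lu eta ltac:(lra))).
  assert (LG2 := filterlim_R_minus U _ _ _ _ HF (Lu T ltac:(lra))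
    (filterlim_R_scal U alpha _ _ HF (LS eta ltac:(lra)))).
  cbv beta in Lue, LG2.
  set (G2 := u T - alpha * RInt (fun s => Rmax (u s) 0) 0 eta) in *.
  assert (Esr : Rmax (u eta) 0 = s * r).
  { assert (L1 := filterlim_R_minus U _ _ _ _ HF Lsr Lue).
    assert (E1 : s * r - Rmax (u eta) 0 <= 0).
    { apply (filterlim_R_le U _ e _ _ HU L1 Le). apply filter_forall. intros n.
      destruct (Hp' n) as (_ & _ & H & _). apply Rabs_le_between in H. lra. }
    assert (E2 : - 1 * 0 <= s * r - Rmax (u eta) 0).
    { apply (filterlim_R_le U (fun n => -1 * e n) _ _ _ HU
        (filterlim_R_scal U (-1) e 0 HF Le) L1).
      apply filter_forall. intros n.
      destruct (Hp' n) as (_ & _ & H & _). apply Rabs_le_between in H. lra. }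
    lra. }
  exists u, v, y, s, r. cbv zeta. fold G2.
  split; [exact (conj Du (conj Dv (conj Cy Py)))|]. split; [exact Ey|]. split; [exact Bs|].
  split; [exact Br|]. split; [exact Esr|]. split; [now rewrite Esr|].
  split; [rewrite U0, V0; field; lra|]. split.
  (* If the limit [G2] is negative, the approximate values lie below [- e n] on a set of [U], so
     there only [rn n <= r0 + e n] can hold. *)
  - destruct (Rle_dec 0 G2) as [H | H]; [now left|right]. apply Rnot_le_lt in H.
    assert (Hh2 : 0 < - G2 / 2) by lra. apply Rle_antisym; [|lra]. rewrite <- (Rplus_0_r r0).
    apply (filterlim_R_le U rn (fun n => r0 + e n) _ _ HU Lr
      (filterlim_R_plus U _ _ _ _ HF (Lc r0) Le)).
    generalize (filter_and _ _ (proj1 (filterlim_R_eps U _ _ HF) Le (- G2 / 2) Hh2)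
      (proj1 (filterlim_R_eps U _ _ HF) LG2 (- G2 / 2) Hh2)).
    apply filter_imp. intros n [H1 H2].
    apply Rabs_lt_between in H1, H2.
    destruct (Hp' n) as (_ & _ & _ & [K | K] & _); [cbv beta in *; lra | exact K].
  - destruct (Rle_dec G2 0) as [H | H]; [now left|right]. apply Rnot_le_lt in H.
    assert (Hh2 : 0 < G2 / 2) by lra. apply Rle_antisym; [lra|]. rewrite <- (Rminus_0_r r1).
    apply (filterlim_R_le U (fun n => r1 - e n) rn _ _ HU
      (filterlim_R_minus U _ _ _ _ HF (Lc r1) Le) Lr).
    generalize (filter_and _ _ (proj1 (filterlim_R_eps U _ _ HF) Le (G2 / 2) Hh2)
      (proj1 (filterlim_R_eps U _ _ HF) LG2 (G2 / 2) Hh2)).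
    apply filter_imp. intros n [H1 H2].
    apply Rabs_lt_between in H1, H2.
    destruct (Hp' n) as (_ & _ & _ & _ & [K | K]); [cbv beta in *; lra | exact K].
Qed.

(** * The boundary value problem *)

Lemma continuous_on_comp_retraction (D : R -> Prop) (f r : R -> R) :
  continuous_on D f -> (forall x, D (r x)) -> (forall x, continuous r x) ->
  forall x, continuous (fun x => f (r x)) x.
Proof.
  intros Hf HD Hr x.
  apply (filterlim_comp _ _ _ r f (locally x) (within D (locally (r x))) (locally (f (r x))));
    [|apply Hf, HD].
  intros P HP. specialize (Hr x _ HP). revert Hr.
  unfold filtermap. apply filter_imp. intros z Hz. apply Hz, HD.
Qed.

Lemma continuous_clamp (T t : R) : 0 <= T -> continuous (clamp T) t.
Proof.
  intros HT. apply (filterlim_locally (F := locally t)). intros e. exists e.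
  intros z Hz. change (Rabs (z - t) < e) in Hz. change (Rabs (clamp T z - clamp T t) < e).
  apply Rle_lt_trans with (2 := Hz). now apply clamp_lipschitz.
Qed.

Lemma continuous_bounded (f : R -> R) (b : R) :
  0 <= b -> (forall t, continuous f t) ->
  exists M, forall t, 0 <= t <= b -> f t <= M.
Proof.
  intros Hb Hf. destruct (continuity_ab_maj f 0 b Hb) as [x [Hx _]].
  - intros c _. apply continuity_pt_filterlim, Hf.
  - now exists (f x).
Qed.

Lemma clamp_unif_cont (f : R -> R) (b : R) :
  0 <= b -> (forall t, continuous f t) ->
  forall e, 0 < e -> exists d, 0 < d /\ forall x x',
    Rabs (x - x') < d -> Rabs (f (clamp b x) - f (clamp b x')) < e.
Proof.
  intros Hb Hf e He.
  destruct (unifcont_1d f 0 b (fun x _ => Hf x) (mkposreal e He)) as [[d Hd] Hu].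
  exists d. split; [exact Hd|]. intros x x' Hx. apply NNPP.
  apply (Hu (clamp b x') (clamp b x)); try now apply clamp_range.
  apply Rle_lt_trans with (2 := Hx). now apply clamp_lipschitz.
Qed.

Lemma mult_unif_cont (p q : R -> R) (Cp Cq : R) :
  (forall t, 0 <= p t <= Cp) -> (forall t, 0 <= q t <= Cq) ->
  (forall e, 0 < e -> exists d, 0 < d /\ forall x x',
    Rabs (x - x') < d -> Rabs (p x - p x') < e) ->
  (forall e, 0 < e -> exists d, 0 < d /\ forall x x',
    Rabs (x - x') < d -> Rabs (q x - q x') < e) ->
  forall e, 0 < e -> exists d, 0 < d /\ forall t t' x x',
    Rabs (t - t') < d -> Rabs (x - x') < d -> Rabs (p t * q x - p t' * q x') < e.
Proof.
  intros Hp Hq Up Uq e He.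
  assert (HCp := Hp 0). assert (HCq := Hq 0).
  set (e' := e / (2 * (1 + Cp + Cq))).
  assert (He' : 0 < e') by (apply Rdiv_lt_0_compat; lra).
  destruct (Up e' He') as [d1 [Hd1 H1]]. destruct (Uq e' He') as [d2 [Hd2 H2]].
  exists (Rmin d1 d2). split; [now apply Rmin_glb_lt|]. intros t t' x x' Ht Hx.
  specialize (H1 t t' (Rlt_le_trans _ _ _ Ht (Rmin_l _ _))).
  specialize (H2 x x' (Rlt_le_trans _ _ _ Hx (Rmin_r _ _))).
  replace (_ - _) with ((p t - p t') * q x + p t' * (q x - q x')) by ring.
  eapply Rle_lt_trans; [apply Rabs_triang|].
  specialize (Hq x). specialize (Hp t').
  rewrite !Rabs_mult, (Rabs_pos_eq (q x)), (Rabs_pos_eq (p t')) by lra.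
  assert (K1 : Rabs (p t - p t') * q x <= e' * Cq)
    by (apply Rmult_le_compat; try lra; apply Rabs_pos).
  assert (K2 : p t' * Rabs (q x - q x') <= Cp * e')
    by (apply Rmult_le_compat; try lra; apply Rabs_pos).
  assert (K3 : e' * (1 + Cp + Cq) = e / 2) by (unfold e'; field; lra).
  lra.
Qed.

Lemma RInt_weight_ge_0 (a : R -> R) (l b : R) :
  l <= b -> (forall t, continuous a t) -> (forall t, 0 <= a t) ->
  0 <= RInt (fun s => (b - s) * a s) l b.
Proof.
  intros Hl Ca Ha. apply RInt_ge_0; [exact Hl | |].
  - apply (ex_RInt_continuous (V := R_CompleteNormedModule)).
    intros; now apply continuous_weight.
  - intros t Ht. apply Rmult_le_pos; [lra | apply Ha].
Qed.

Lemma RInt_weight_gt_0 (a : R -> R) (l b t0 : R) :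
  l < b -> (forall t, continuous a t) -> (forall t, 0 <= a t) ->
  l <= t0 <= b -> 0 < a t0 ->
  0 < RInt (fun s => (b - s) * a s) l b.
Proof.
  intros Hl Ca Ha Ht0 Hpos.
  destruct (proj1 (filterlim_locally (F := locally t0) a (a t0)) (Ca t0) (mkposreal _ Hpos))
    as [[d Hd] Hball].
  assert (Hnear : forall t, Rabs (t - t0) < d -> 0 < a t).
  { intros t Ht. specialize (Hball t Ht). change (Rabs (a t - a t0) < a t0) in Hball.
    apply Rabs_lt_between in Hball. lra. }
  (* The point [t0] may be an endpoint, even [b], where the weight vanishes. The half ball around it
     cut to [[l, b]] is still nondegenerate, with a positive integrand inside. *)
  set (c := Rmax l (t0 - d / 2)). set (e := Rmin b (t0 + d / 2)).
  assert (Hc : l <= c /\ t0 - d / 2 <= c) by (split; [apply Rmax_l | apply Rmax_r]).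
  assert (He : e <= b /\ e <= t0 + d / 2) by (split; [apply Rmin_l | apply Rmin_r]).
  assert (Hce : c < e).
  { unfold c, e. apply Rmax_lub_lt; apply Rmin_glb_lt; lra. }
  assert (Hex : forall p q, ex_RInt (fun s => (b - s) * a s) p q).
  { intros. apply (ex_RInt_continuous (V := R_CompleteNormedModule)).
    intros; now apply continuous_weight. }
  rewrite <- (RInt_Chasles (V := R_CompleteNormedModule) _ l c b) by apply Hex.
  rewrite <- (RInt_Chasles (V := R_CompleteNormedModule) _ c e b) by apply Hex.
  assert (H1 : 0 <= RInt (fun s => (b - s) * a s) l c).
  { apply RInt_ge_0; [lra | apply Hex |]. intros t Ht.
    apply Rmult_le_pos; [lra | apply Ha]. }
  assert (H3 := RInt_weight_ge_0 a e b (proj1 He) Ca Ha).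
  assert (H2 : 0 < RInt (fun s => (b - s) * a s) c e).
  { apply RInt_gt_0; [exact Hce | |].
    - intros t Ht. apply Rmult_lt_0_compat; [lra|]. apply Hnear.
      apply Rabs_lt_between. lra.
    - intros; now apply continuous_weight. }
  exact (Rplus_le_lt_0_compat _ _ H1 (Rplus_lt_le_0_compat _ _ H2 H3)).
Qed.

(** * Slopes of the nonlinearity, positivity and regularity *)

Lemma lim_ratio_value_0 (f : R -> R) (l : R) :
  continuous_on (fun x => 0 <= x) f ->
  filterlim (fun x => f x / x) (at_right 0) (locally l) -> f 0 = 0.
Proof.
  intros Hf Hl.
  assert (H1 : filterlim f (at_right 0) (locally (f 0))).
  { intros P HP. specialize (Hf 0 (Rle_refl 0) P HP). revert Hf.
    unfold filtermap, at_right, within. apply filter_imp. intros x Hx Hx0. apply Hx; lra. }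
  assert (H2 : filterlim (fun x => f x / x * x) (at_right 0) (locally (l * 0))).
  { apply (filterlim_comp_2 (fun x => f x / x) (fun x => x) Rmult Hl) with (2 := filterlim_mult l 0).
    intros P HP. revert HP. unfold filtermap, at_right, within.
    apply filter_imp. auto. }
  rewrite Rmult_0_r in H2.
  apply (filterlim_locally_unique (F := at_right 0) f); [exact H1|].
  apply (filterlim_ext_loc (F := at_right 0) (fun x => f x / x * x)); [|exact H2].
  unfold at_right, within. apply filter_forall. intros x Hx. field. lra.
Qed.

Lemma lim_ratio_small (f : R -> R) (l kappa : R) :
  continuous_on (fun x => 0 <= x) f ->
  filterlim (fun x => f x / x) (at_right 0) (locally l) -> l < kappa ->
  exists sigma, 0 < sigma /\
    forall x, x <= sigma -> f (Rmax x 0) <= kappa * Rmax x 0.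
Proof.
  intros Hf Hl Hk.
  destruct (Hl (fun z => z < kappa) (open_lt kappa l Hk)) as [[d Hd] H].
  exists (d / 2). split; [lra|]. intros x Hx. unfold Rmax. destruct Rle_dec.
  (* For [x <= 0] both sides are 0, because a finite slope at 0 forces [f 0 = 0]. *)
  - rewrite (lim_ratio_value_0 f l Hf Hl). lra.
  - assert (Hlt : f x / x < kappa).
    { apply H; [|lra]. change (Rabs (x - 0) < d). rewrite Rminus_0_r, Rabs_pos_eq; lra. }
    left. apply Rlt_div_l; lra.
Qed.

Lemma lim_ratio_large (f : R -> R) (l kappa : R) :
  is_lim (fun x => f x / x) p_infty (Finite l) -> kappa < l ->
  exists m, 0 < m /\ forall x, m <= x -> kappa * x <= f x.
Proof.
  intros Hl Hk.
  destruct (Hl (fun z => kappa < z) (open_gt kappa l Hk)) as [m H].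
  exists (Rmax m 0 + 1). assert (H0 := Rmax_r m 0). assert (H1 := Rmax_l m 0).
  split; [lra|]. intros x Hx. assert (Hlt : kappa < f x / x) by (apply H; lra).
  left. apply Rlt_div_r; lra.
Qed.

(** An interior zero at [t] would, by the chord to [T], make [u] vanish on [[0, t]]. The hypothesis
    on the tangent then gives [v 0 > 0], whereas [y <= Y] keeps the slope positive for a while. *)
Lemma concave_sol_positive (u v y : R -> R) (T eta Y : R) :
  concave_sol u v y -> 0 < eta < T -> (forall t, 0 <= t <= T -> y t <= Y) ->
  0 <= u 0 -> 0 <= u T -> 0 < u 0 + v 0 * eta ->
  (forall t, 0 <= t <= T -> 0 <= u t) /\ (forall t, 0 < t < T -> 0 < u t).
Proof.
  intros H He HY H0 HT Hline.
  assert (Hpos : forall t, 0 <= t <= T -> 0 <= u t).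
  { intros t Ht. assert (C := concave_sol_chord u v y 0 t T H ltac:(lra) ltac:(lra)).
    assert (0 <= (T - t) * u 0 + (t - 0) * u T)
      by (apply Rplus_le_le_0_compat; apply Rmult_le_pos; lra).
    apply Rmult_le_reg_l with (T - 0); lra. }
  split; [exact Hpos|]. intros t Ht. apply Rnot_le_lt. intros Hut.
  assert (Hzero : forall x, 0 <= x <= t -> u x = 0).
  { intros x Hx. assert (C := concave_sol_chord u v y x t T H ltac:(lra) ltac:(lra)).
    assert (Hux := Hpos x ltac:(lra)).
    assert (0 <= (t - x) * u T) by (apply Rmult_le_pos; lra).
    assert ((T - x) * u t <= 0) by nra.
    apply Rle_antisym; [|exact Hux]. apply Rmult_le_reg_l with (T - t); lra. }
  assert (Hv0 : 0 < v 0) by (rewrite (Hzero 0) in Hline by lra; nra).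
  assert (HY0 : 0 <= Y).
  { apply Rle_trans with (y 0); [apply H | apply HY; lra]. }
  (* Short enough that [Y * x < v 0]: the slope cannot drop from [v 0] to 0 within [[0, x]]. *)
  set (x := Rmin t (v 0 / (Y + 1))).
  assert (Hx1 : x <= t) by apply Rmin_l.
  assert (Hx2 : x <= v 0 / (Y + 1)) by apply Rmin_r.
  assert (Hx0 : 0 < x) by (apply Rmin_glb_lt; [lra | apply Rdiv_lt_0_compat; lra]).
  destruct (is_derive_increment u v 0 x (proj1 H) ltac:(lra)) as [z [Hz Ez]].
  rewrite (Hzero x), (Hzero 0) in Ez by lra.
  assert (Hvz : v z = 0) by nra.
  destruct (is_derive_increment v (fun t => - y t) 0 z (proj1 (proj2 H)) ltac:(lra))
    as [w [Hw Ew]].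
  rewrite Hvz in Ew. specialize (HY w ltac:(lra)).
  assert (Hyw : y w * z <= Y * x).
  { apply Rmult_le_compat; try lra. apply H. }
  apply (Rmult_le_compat_l (Y + 1)) in Hx2; [|lra].
  replace ((Y + 1) * (v 0 / (Y + 1))) with (v 0) in Hx2 by (field; lra).
  lra.
Qed.

Lemma concave_sol_C2 (u v y : R -> R) :
  concave_sol u v y ->
  (forall t, Derive_n u 2 t = - y t) /\ (forall l r, C2_on_open l r u).
Proof.
  intros (Du & Dv & Cy & _).
  assert (E1 : forall t, Derive u t = v t) by (intros t; now apply is_derive_unique).
  assert (E2 : forall t, Derive_n u 2 t = - y t).
  { intros t. change (Derive (fun x => Derive u x) t = - y t).
    rewrite (Derive_ext (fun x => Derive u x) v t E1). now apply is_derive_unique. }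
  split; [exact E2|]. intros l r t _. split; [|split].
  - eexists; apply Du.
  - apply (ex_derive_ext v); [intros; now rewrite E1|]. eexists; apply Dv.
  - apply (continuous_ext (fun s => - y s)); [intros; now rewrite E2|].
    apply (continuous_opp y), Cy.
Qed.

Theorem corollary4p2
  (T eta alpha beta : R) (f a : R -> R)
  (Heta : 0 < eta < T)
  (Halpha : 0 < alpha < 2 * T / eta ^ 2)
  (Hbeta : 0 <= beta
           < (2 * T - alpha * eta ^ 2) / (alpha * eta ^ 2 - 2 * eta + 2 * T))
  (Hf_cont : continuous_on (fun x => 0 <= x) f)
  (Hf_nonneg : forall x, 0 <= x -> 0 <= f x)
  (Ha_cont : continuous_on (fun t => 0 <= t <= T) a)
  (Ha_nonneg : forall t, 0 <= t <= T -> 0 <= a t)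
  (Ha_pos : exists t0, eta <= t0 <= T /\ 0 < a t0)
  (theta1 theta2 alpha1 beta1 : R)
  (Htheta1 : 0 < theta1 <= 1)
  (Hlim0 : filterlim (fun x => f x / x) (at_right 0) (locally alpha1))
  (Halpha1 : 0 <= alpha1 < theta1 * Lambda1 T eta alpha beta a)
  (Htheta2 : 1 <= theta2)
  (Hliminf : is_lim (fun x => f x / x) p_infty (Finite beta1))
  (Hbeta1 : theta2 / gamma T eta alpha beta * Lambda2 T eta alpha beta a < beta1) :
  exists u : R -> R, positive_solution T eta alpha beta f a u.
Proof.
  assert (Heta2 : 0 < eta ^ 2) by (apply pow_lt; lra).
  assert (Hae2 : 0 < alpha * eta ^ 2) by (apply Rmult_lt_0_compat; lra).
  set (D := bvp_det T eta alpha beta).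
  assert (HD : 0 < D).
  { destruct Hbeta as [_ Hb]. apply Rlt_div_r in Hb; [|lra].
    unfold D, bvp_det. lra. }
  set (a' := fun t => a (clamp T t)).
  assert (Ca' : forall t, continuous a' t).
  { apply (continuous_on_comp_retraction (fun t => 0 <= t <= T) a (clamp T)); auto.
    - intros; apply clamp_range; lra.
    - intros; apply continuous_clamp; lra. }
  assert (Pa' : forall t, 0 <= a' t).
  { intros t. apply Ha_nonneg, clamp_range. lra. }
  assert (Ea' : forall t, 0 <= t <= T -> a' t = a t).
  { intros t Ht. unfold a'. now rewrite clamp_id. }
  set (W := RInt (fun s => (T - s) * a' s) 0 T : R).
  set (V := RInt (fun s => (T - s) * a' s) eta T : R).
  assert (HW : 0 <= W) by (apply RInt_weight_ge_0; auto; lra).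
  assert (HV : 0 < V).
  { destruct Ha_pos as [t0 [Ht0 Hat0]].
    apply (RInt_weight_gt_0 a' eta T t0); auto; try lra. rewrite Ea'; lra. }
  assert (EW : RInt (fun s => T * (T - s) * a s) 0 T = T * W :> R).
  { unfold W. rewrite <- (RInt_scal (V := R_CompleteNormedModule)).
    - apply RInt_ext. intros t Ht. rewrite Rmin_left, Rmax_right in Ht by lra.
      rewrite <- Ea' by lra. apply Rmult_assoc.
    - apply (ex_RInt_continuous (V := R_CompleteNormedModule)).
      intros; now apply continuous_weight. }
  assert (EV : RInt (fun s => (T - s) * a s) eta T = V :> R).
  { apply RInt_ext. intros t Ht. rewrite Rmin_left, Rmax_right in Ht by lra.
    rewrite <- Ea' by lra. reflexivity. }
  set (E := 2 * (beta + 1) * T + beta * eta * (alpha * eta + 2) + alpha * beta * T ^ 2).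
  (* The factor [T] inside the integral of [Lambda1] clears the [/ T] of its bracket. *)
  assert (HL1 : Lambda1 T eta alpha beta a = D / (E * W)).
  { unfold Lambda1. rewrite EW. fold D. f_equal. unfold E. field. lra. }
  set (g0 := gamma T eta alpha beta) in *.
  assert (HL2 : Lambda2 T eta alpha beta a = D / (2 * g0 * eta * V)).
  { unfold Lambda2. rewrite EV. reflexivity. }
  assert (HE : 0 < E).
  { unfold E. assert (0 <= beta * eta * (alpha * eta + 2)).
    { apply Rmult_le_pos; [apply Rmult_le_pos; lra|].
      assert (0 < alpha * eta) by (apply Rmult_lt_0_compat; lra). lra. }
    assert (0 <= alpha * beta * T ^ 2).
    { apply Rmult_le_pos; [apply Rmult_le_pos; lra | apply pow2_ge_0]. }
    assert (0 < 2 * (beta + 1) * T) by (apply Rmult_lt_0_compat; lra). lra. }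
  assert (Hg : 0 < g0 /\ g0 <= eta / T /\ g0 <= alpha * (beta + 1) * eta ^ 2 / (2 * T)).
  { assert (Hab : 0 < alpha * (beta + 1)) by (apply Rmult_lt_0_compat; lra).
    (* This denominator of the third entry of [gamma] equals [D + 2 * beta * (T - eta)]. *)
    assert (Hden : 0 < 2 * T - alpha * (beta + 1) * eta ^ 2).
    { assert (0 <= beta * (T - eta)) by (apply Rmult_le_pos; lra).
      unfold D, bvp_det in HD. lra. }
    unfold g0, gamma. split; [|split].
    - repeat apply Rmin_glb_lt; apply Rdiv_lt_0_compat; try lra;
        repeat apply Rmult_lt_0_compat; try lra.
    - apply Rmin_l.
    - apply Rle_trans with (1 := Rmin_r _ _). apply Rmin_l. }
  destruct Hg as (Hg0 & Hg1 & Hg2).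
  assert (HeT : eta / T < 1) by (apply Rlt_div_l; lra).
  assert (Hg3 : g0 <= alpha * eta * (1 + beta) / 2).
  { apply Rle_trans with (1 := Hg2).
    replace (alpha * (beta + 1) * eta ^ 2 / (2 * T))
      with (alpha * eta * (1 + beta) / 2 * (eta / T)) by (field; lra).
    rewrite <- (Rmult_1_r (alpha * eta * (1 + beta) / 2)) at 2.
    apply Rmult_le_compat_l; [|lra].
    assert (0 < alpha * eta * (1 + beta)) by (repeat apply Rmult_lt_0_compat; lra). lra. }
  (* [k1] and [k2] are midpoints between the slopes of [f] and their thresholds: they bound the
     ratio near 0 and at infinity and still satisfy the strict inequalities of the two estimates. *)
  set (k1 := (alpha1 + Lambda1 T eta alpha beta a) / 2).
  assert (HaL : alpha1 < Lambda1 T eta alpha beta a).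
  { destruct (Rle_dec (Lambda1 T eta alpha beta a) 0); nra. }
  assert (Hk1 : k1 * (E * W) < D).
  { destruct (Req_dec (E * W) 0) as [-> | Hne]; [lra|].
    assert (0 < E * W) by (assert (0 <= E * W) by (apply Rmult_le_pos; lra); lra).
    apply Rlt_div_r; [lra|]. unfold k1. rewrite HL1 in *. lra. }
  assert (HL2p : 0 < Lambda2 T eta alpha beta a).
  { rewrite HL2. apply Rdiv_lt_0_compat; [lra|]. repeat apply Rmult_lt_0_compat; lra. }
  set (k2 := (beta1 + Lambda2 T eta alpha beta a) / 2).
  assert (HbL : Lambda2 T eta alpha beta a < beta1).
  { apply Rle_lt_trans with (2 := Hbeta1).
    rewrite <- (Rmult_1_l (Lambda2 T eta alpha beta a)) at 1.
    apply Rmult_le_compat_r; [lra|]. apply Rle_div_r; lra. }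
  assert (Hk2 : D < 2 * eta * g0 * k2 * V).
  { assert (Hq : 0 < 2 * g0 * eta * V) by (repeat apply Rmult_lt_0_compat; lra).
    replace (2 * eta * g0 * k2 * V) with (k2 * (2 * g0 * eta * V)) by ring.
    apply Rlt_div_l; [lra|]. unfold k2. rewrite HL2 in *. lra. }
  destruct (lim_ratio_small f alpha1 k1 Hf_cont Hlim0) as [sigma [Hsigma Hsmall]];
    [unfold k1; lra|].
  destruct (lim_ratio_large f beta1 k2 Hliminf) as [m0 [Hm0 Hlarge]];
    [unfold k2; lra|].
  set (fc := fun x => f (Rmax x 0)).
  assert (Cfc : forall x, continuous fc x).
  { apply (continuous_on_comp_retraction (fun x => 0 <= x) f (fun x => Rmax x 0)); auto.
    - intros; apply Rmax_r.
    - apply continuous_Rmax0. }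
  assert (Pfc : forall x, 0 <= fc x) by (intros; apply Hf_nonneg, Rmax_r).
  set (m1 := m0 / g0 * T / (T - eta)).
  assert (Hm0g : 0 < m0 / g0) by (apply Rdiv_lt_0_compat; lra).
  assert (Hm1 : 0 < m1).
  { apply Rdiv_lt_0_compat; [apply Rmult_lt_0_compat|]; lra. }
  destruct (continuous_bounded fc m1 ltac:(lra) Cfc) as [Fm HFm].
  assert (HFm0 : 0 <= Fm) by (apply Rle_trans with (2 := HFm 0 ltac:(lra)); apply Pfc).
  destruct (continuous_bounded a' T ltac:(lra) Ca') as [am Ham].
  assert (Ham' : forall t, 0 <= a' t <= am).
  { intros t. split; [apply Pa'|]. specialize (Ham (clamp T t)).
    assert (R0 := clamp_range T t ltac:(lra)). unfold a' in Ham |- *.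
    rewrite (clamp_id T (clamp T t)) in Ham by exact R0. now apply Ham. }
  (* One more than the bound that [large_solution] requires [rho] to exceed. *)
  set (r1 := m0 / g0 + eta ^ 2 * (am * Fm) + 1).
  assert (Hr1 : 1 < r1).
  { assert (Ham0 := Ham' 0).
    assert (0 <= eta ^ 2 * (am * Fm)) by (apply Rmult_le_pos; [|apply Rmult_le_pos]; lra).
    unfold r1. lra. }
  (* Since [u 0 <= beta * r], and the tangent at 0 has value [r] at [eta] and at most
     [r * (T / eta)] at [T], both [u 0] and its value at [T] are at most [r * C]. *)
  set (C := beta + T / eta).
  assert (HTe : 0 < T / eta) by (apply Rdiv_lt_0_compat; lra).
  assert (HC : 0 < C) by (unfold C; lra).
  set (M := r1 * C). assert (HM : 0 < M) by (apply Rmult_lt_0_compat; lra).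
  (* At [r = r0] the tangent stays below both [sigma] and [M]; the bound [1 / 2] ensures
     [r0 < r1]. *)
  set (r0 := Rmin (Rmin sigma M / C) (1 / 2)).
  assert (HsM : 0 < Rmin sigma M) by now apply Rmin_glb_lt.
  assert (Hr0 : 0 < r0).
  { apply Rmin_glb_lt; [apply Rdiv_lt_0_compat; lra | lra]. }
  assert (Hr01 : r0 < r1) by (assert (r0 <= 1 / 2) by apply Rmin_r; lra).
  assert (Hr0C : r0 * C <= Rmin sigma M) by (apply Rle_div_r; [lra | apply Rmin_l]).
  (* [f] is truncated at the a priori bound [M] of all solutions considered. *)
  set (F := fun x => fc (clamp M x)).
  assert (PF : forall x, 0 <= F x) by (intros; apply Pfc).
  destruct (continuous_bounded fc M ltac:(lra) Cfc) as [FM HFM].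
  assert (BF : forall x, 0 <= F x <= FM).
  { intros x. split; [apply PF|]. apply HFM, clamp_range. lra. }
  assert (EF : forall x, x <= M -> F x = f (Rmax x 0)).
  { intros x Hx. unfold F, fc. f_equal. unfold clamp. rewrite Rmin_left by lra.
    rewrite (Rmax_comm 0), Rmax_left by apply Rmax_r. reflexivity. }
  assert (Hga : forall t, a' t = a' (clamp T t)).
  { intros t. unfold a'. rewrite (clamp_id T (clamp T t)); auto. apply clamp_range. lra. }
  destruct (shooting_solution (fun t x => a' t * F x) T eta alpha beta r0 r1 (am * FM))
    as (u & v & y & s & r & H & Hy & Hs & Hr & Hue & Hu0 & Hline & HG1 & HG2); auto; try lra.
  { intros t x. specialize (Ham' t). specialize (BF x). split.
    - apply Rmult_le_pos; lra.
    - apply Rmult_le_compat; lra. }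
  { apply (mult_unif_cont a' F am FM Ham' BF).
    - intros e He. destruct (clamp_unif_cont a' T ltac:(lra) Ca' e He) as [d [Hd Hu]].
      exists d. split; [exact Hd|]. intros x x' Hx. rewrite (Hga x), (Hga x'). now apply Hu.
    - apply clamp_unif_cont; [lra | exact Cfc]. }
  cbv beta in Hy.
  assert (Hu0C : u 0 <= r * C /\ u 0 + v 0 * T <= r * C).
  { assert (Hu0' : 0 <= u 0 <= beta * r).
    { rewrite Hu0, Hue. split.
      - repeat apply Rmult_le_pos; lra.
      - apply Rmult_le_compat_l; [lra|].
        rewrite <- (Rmult_1_l r) at 2. apply Rmult_le_compat_r; lra. }
    assert (Hrt : 0 < r * (T / eta)) by (apply Rmult_lt_0_compat; lra).
    split; [unfold C; lra|].
    replace (v 0) with ((r - u 0) / eta) by (rewrite <- Hline; field; lra).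
    replace (u 0 + (r - u 0) / eta * T) with (r * (T / eta) + u 0 * (1 - T / eta))
      by (field; lra).
    assert (HTe1 : 1 <= T / eta) by (apply Rle_div_r; lra).
    assert (u 0 * (1 - T / eta) <= 0) by nra.
    assert (0 <= r * beta) by (apply Rmult_le_pos; lra).
    unfold C. lra. }
  assert (HrM : r * C <= M) by (unfold M; apply Rmult_le_compat_r; lra).
  assert (HG : u T - alpha * RInt (fun s => Rmax (u s) 0) 0 eta = 0 :> R).
  { assert (Hsm : r = r0 -> alpha * RInt (fun s => Rmax (u s) 0) 0 eta < u T).
    { intros Er. apply (small_solution T eta alpha beta k1 (Rmin sigma M) r a' F u v y);
        auto; try lra.
      - unfold k1. rewrite HL1 in *. lra.
      - intros x Hx. assert (x <= sigma) by (apply Rle_trans with (1 := Hx), Rmin_l).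
        assert (x <= M) by (apply Rle_trans with (1 := Hx), Rmin_r).
        rewrite EF by assumption. now apply Hsmall.
      - rewrite Er in Hu0C. lra.
      - rewrite Er in Hu0C. lra. }
    assert (Hlg : r = r1 -> u T < alpha * RInt (fun s => Rmax (u s) 0) 0 eta).
    { intros Er. apply (large_solution T eta alpha beta k2 g0 m0 Fm am M r a' F u v y);
        auto; try lra.
      - unfold k2. lra.
      - intros x Hx. rewrite EF, Rmax_left by lra. apply Hlarge. lra.
      - intros x Hx. unfold F. apply HFm. fold m1 in Hx. unfold clamp.
        assert (Rmin x M <= x) by apply Rmin_l.
        split; [apply Rmax_l | apply Rmax_lub; lra].
      - rewrite Er. unfold r1. lra. }
    destruct HG1 as [HG1 | HG1], HG2 as [HG2 | HG2]; try specialize (Hsm HG1);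
      try specialize (Hlg HG2); lra. }
  assert (HuT0 : 0 <= u T).
  { replace (u T) with (alpha * RInt (fun s => Rmax (u s) 0) 0 eta) by lra.
    apply Rmult_le_pos; [lra|]. apply RInt_ge_0; [lra| |intros; apply Rmax_r].
    apply (ex_RInt_continuous (V := R_CompleteNormedModule)). intros z _.
    apply (continuous_comp u (fun z => Rmax z 0)); [|apply continuous_Rmax0].
    apply (ex_derive_continuous u). eexists; apply (proj1 H). }
  assert (Hu00 : 0 <= u 0).
  { rewrite Hu0. apply Rmult_le_pos; [lra | apply Rmax_r]. }
  destruct (concave_sol_positive u v y T eta (am * FM) H Heta) as [Hnn Hpos]; auto; try lra.
  { intros t Ht. rewrite Hy by exact Ht. specialize (Ham' t). specialize (BF (u t)).
    apply Rmult_le_compat; lra. }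
  destruct (concave_sol_C2 u v y H) as [E2 HC2].
  exists u. split; [|split; [apply HC2|split; [split; [|split]|split; [exact Hnn | exact Hpos]]]].
  - intros t _. apply (filterlim_filter_le_1 (F := locally t)).
    + apply filter_le_within.
    + apply (ex_derive_continuous u). eexists; apply (proj1 H).
  - intros t Ht. rewrite E2, Hy, Ea' by lra.
    (* The truncation is inactive: [u] lies below its tangent at 0, which is at most [M] on
       [[0, T]]. *)
    destruct (concave_sol_tangent u v y 0 t H) as [Hut _]; [lra|].
    rewrite EF, Rmax_left.
    + lra.
    + apply Hnn. lra.
    + apply Rle_trans with (1 := Hut). rewrite Rminus_0_r.
      destruct (Rle_dec 0 (v 0)).
      * apply Rle_trans with (u 0 + v 0 * T); [|lra].
        apply Rplus_le_compat_l, Rmult_le_compat_l; lra.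
      * nra.
  - rewrite Hu0, Rmax_left; [reflexivity | apply Hnn; lra].
  - rewrite RInt_pos_part in HG; [lra | lra |]. intros; apply Hnn; lra.
Qed.
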